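(* Let $n$ be a positive integer, let $N_*$ be a finite index set and let $N \subsetneq N_*$ with $p := \#N < p_* := \#N_* < n$. Let $\mathbf{y} \in \mathbb{R}^n$ and $\mathbf{x}_\nu \in \mathbb{R}^n$, $\nu \in N$, be fixed vectors such that the $p+1$ vectors $\mathbf{y}$ and $\mathbf{x}_\nu$, $\nu \in N$, are linearly independent. Let $\mathbf{z}_\nu$, $\nu \in N_* \setminus N$, be stochastically independent random vectors with $\mathbf{z}_\nu \sim \mathcal{N}_n(\mathbf{0}, \mathbf{I}_n)$, and set $\mathbf{x}_\nu := \mathbf{z}_\nu$ for $\nu \in N_* \setminus N$. For $M \subset N_*$ let $\mathbb{V}_M := \mathrm{span}(\mathbf{x}_\nu : \nu \in M)$, let $\widehat{\mathbf{y}}_M$ be the orthogonal projection of $\mathbf{y}$ onto $\mathbb{V}_M$, and let $\mathrm{SS}_M := \|\mathbf{y} - \widehat{\mathbf{y}}_M\|^2$. Then $\mathrm{SS}_{N_*}$ is a random variable and \[ \frac{\mathrm{SS}_{N_*}}{\mathrm{SS}_N} \ \sim \ \mathrm{Beta}\bigl( (n - p_* )/2, \, (p_* - p)/2 \bigr). \]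
   Context: $\mathcal{N}_n(\mathbf{0},\mathbf{I}_n)$ is the standard Gaussian distribution on $\mathbb{R}^n$ ($\mathbf{I}_n$ the identity matrix). $\mathrm{Beta}(a,b)$ denotes the beta distribution on $(0,1)$ with density proportional to $u^{a-1}(1-u)^{b-1}$. If $N=\emptyset$, $\mathbb{V}_\emptyset := \{\mathbf{0}\}$ and $\widehat{\mathbf{y}}_\emptyset := \mathbf{0}$. *)

(* Defs.v *)
From HB Require Import structures.
From mathcomp Require Import all_boot all_order all_algebra.
From mathcomp Require Import all_classical all_reals all_analysis.
Set Implicit Arguments. Unset Strict Implicit. Unset Printing Implicit Defensive.
Import Order.TTheory GRing.Theory Num.Theory.
Local Open Scope classical_set_scope.
Local Open Scope ring_scope.

Section defs.
Context {R : realType}.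

Definition span_of (I : finType) (n : nat) (M : {set I}) (x : I -> 'rV[R]_n)
  : 'M[R]_n := (\sum_(nu in M) <<x nu>>)%MS.

Definition oproj (n : nat) (V : 'M[R]_n) (y : 'rV[R]_n) : 'rV[R]_n :=
  xget 0 [set v : 'rV[R]_n | (v <= V)%MS /\
          forall u : 'rV[R]_n, (u <= V)%MS -> (y - v) *m u^T = 0].

Definition sqnorm (n : nat) (v : 'rV[R]_n) : R := \sum_(i < n) v 0 i ^+ 2.

Definition SS (I : finType) (n : nat) (M : {set I}) (x : I -> 'rV[R]_n)
  (y : 'rV[R]_n) : R := sqnorm (y - oproj (span_of M x) y).

Definition beta_dens (a b : R) (u : R) : R :=
  u `^ (a - 1) * (1 - u) `^ (b - 1).

Definition beta_meas (a b : R) (A : set R) : \bar R :=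
  ((\int[lebesgue_measure]_(u in A `&` `]0%R, 1%R[) (beta_dens a b u)%:E) *
   ((fine (\int[lebesgue_measure]_(u in `]0%R, 1%R[) (beta_dens a b u)%:E))^-1)%:E)%E.

End defs.

Section indep.
Context {d : measure_display} {T : measurableType d} {R : realType}.

(** Mutual independence of the real random variables X k, k in S
    (product rule over every choice of Borel sets; taking B k = setT
    for some k gives the rule for every subfamily). *)
Definition mutually_independent (K : finType) (P : probability T R)
  (S : {set K}) (X : K -> T -> R) : Prop :=
  forall B : K -> set R, (forall k, measurable (B k)) ->
    P [set t | forall k, k \in S -> B k (X k t)] =
    (\prod_(k in S) P (X k @^-1` B k))%E.

End indep.

(* Main.v *)
(** A random row is added one at a time.  Let V be a fixed subspace of dimension m
    not containing y, and let w be a standard Gaussian vector.  A product H of plane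
    (Givens) rotations makes V the span of the first m coordinate vectors and puts y in the
    span of the first m + 1; it preserves the law of w, so with g = w H the ratio of the
    squared distances of y to V + w and to V is
    1 - g_m^2 / (g_m^2 + g_(m+1)^2 + ... + g_(n-1)^2), a ratio of independent sums of
    squares, hence Beta((n - m - 1)/2, 1/2).  The distributional facts needed, that sums of
    independent gamma variables are gamma and the ratio is beta, come from one affine
    change of variables.  Freezing the first random row by Tonelli's theorem, the remaining
    ones give by induction a conditional Beta(a, b) law which does not depend on the frozen
    row, and the product of independent Beta(a + b, 1/2) and Beta(a, b) variables is
    Beta(a, b + 1/2).

    Laws are handled through integrals of nonnegative measurable functions, against
    unnormalised densities; the constants are recovered from the total mass. *)
Require Import Defs.
From HB Require Import structures.
From mathcomp Require Import all_boot all_order all_algebra.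
From mathcomp Require Import all_classical all_reals all_analysis.
From mathcomp Require Import measurable_realfun ring lra.
Set Implicit Arguments. Unset Strict Implicit. Unset Printing Implicit Defensive.
Import Order.TTheory GRing.Theory Num.Theory numFieldNormedType.Exports.
Local Open Scope classical_set_scope.
Local Open Scope ring_scope.

(** * Joint laws of independent families *)

(** Independence is given only as a product rule over boxes of scalar coordinates. Conditioning on a
    row is therefore expressed by redrawing: the other coordinates are read at a second, independent
    sample point, and the joint law is unchanged because both laws agree on boxes. Redrawing one or
    two coordinates likewise replaces n-dimensional Gaussian integrals: a plane rotation touches two
    coordinates only, so rotation invariance reduces to a substitution in the plane, itself composed
    of affine substitutions on the line.

    The conditional law is available only for almost every frozen row, since y must stay outside the
    enlarged span; the exceptional rows lie in the span of V and y, which is a proper subspace.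

    Constants are kept in [0, +oo]: once a constant times the mass of the density is known to be 1,
    both are finite and nonzero, so neither the gamma function nor the convergence of a beta
    integral has to be studied. *)

Section cylinders.
Context (R : realType) (K : finType).

Definition cylinder (B : K -> set R) : set (K -> R) :=
  [set h | forall k, B k (h k)].

Definition cylinders : set (set (K -> R)) :=
  [set A | exists2 B : K -> set R, (forall k, measurable (B k)) & A = cylinder B].

(** A separate name for [K -> R], so that the sigma-algebra generated by the cylinders can be
    attached to it without touching the bare function type. *)
Definition product_space : Type := K -> R.

HB.instance Definition _ := gen_eqMixin product_space.
HB.instance Definition _ := gen_choiceMixin product_space.
HB.instance Definition _ := isPointed.Build product_space (fun=> 0).
HB.instance Definition _ := @isMeasurable.Build (sigma_display cylinders)
  product_space <<s cylinders >> (@sigma_algebra0 _ setT cylinders)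
  (@sigma_algebraC product_space cylinders) (@sigma_algebra_bigcup _ setT cylinders).

Lemma measurable_cylinder B : (forall k, measurable (B k)) ->
  measurable (cylinder B : set product_space).
Proof. by move=> mB; apply: sub_sigma_algebra; exists B. Qed.

Lemma measurable_coord k : measurable_fun [set: product_space] (fun h => h k).
Proof.
move=> _ Y mY; rewrite setTI.
rewrite [X in measurable X](_ : _ = cylinder (fun j => if j == k then Y else setT)).
  by apply: measurable_cylinder => j; case: ifP.
apply/seteqP; split=> [h/= hY j|h /(_ k)]; last by rewrite eqxx.
by case: eqP => // ->.
Qed.

Lemma measurable_to_product_space d (T : measurableType d) (f : T -> product_space) :
  (forall k, measurable_fun [set: T] (fun t => f t k)) -> measurable_fun [set: T] f.
Proof.
move=> mf; apply: (@measurability _ _ _ _ setT f cylinders) => //.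
move=> _ [_ [B mB ->] <-].
rewrite [X in measurable X](_ : _ =
  \bigcap_(k in [set: K]) ([set: T] `&` (fun t => f t k) @^-1` B k)).
  apply: fin_bigcap_measurable; first exact: finite_finset.
  by move=> k _; exact: mf.
apply/seteqP; split=> [t [_ Bt] k _|t H]; first by split=> //; exact: Bt.
by split=> // k; case: (H k I).
Qed.

(** Cylinders are stable under intersection, contain the whole space and generate the sigma-algebra,
    so they determine a finite measure. *)
Lemma product_measure_eq (m1 m2 : {measure set product_space -> \bar R}) :
  (m1 setT < +oo)%E ->
  (forall B, (forall k, measurable (B k)) -> m1 (cylinder B) = m2 (cylinder B)) ->
  forall A, measurable A -> m1 A = m2 A.
Proof.
move=> m1oo m12 A mA.
apply: (@measure_unique _ _ product_space cylinders (fun=> setT)) => //.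
- move=> _ _ [B1 mB1 ->] [B2 mB2 ->]; exists (fun k => B1 k `&` B2 k).
    by move=> k; exact: measurableI.
  apply/seteqP; split=> [h [h1 h2] k|h H]; first by split.
  by split=> k; case: (H k).
- by move=> _; exists (fun=> setT) => //; apply/seteqP; split.
- by rewrite bigcup_const.
- by move=> _ [B mB ->]; exact: m12.
Qed.

End cylinders.

Section decoupling.
Context (R : realType) (K : finType) (d : measure_display) (T : measurableType d).
Variables (P : probability T R) (X : K -> T -> R).
Hypothesis mX : forall k, measurable_fun [set: T] (X k).
Hypothesis indepX : mutually_independent P [set: K] X.
Local Open Scope ereal_scope.

Lemma indep_cylinder B : (forall k, measurable (B k)) ->
  P [set t | cylinder B (X^~ t)] = \prod_k P (X k @^-1` B k).
Proof.
move=> mB; have := indepX mB.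
rewrite [RHS](eq_bigl xpredT) => [<-|k]; last by rewrite finset.in_setT.
by congr (P _); apply/seteqP; split=> t /= H k; [move=> _|]; apply: H; rewrite ?finset.in_setT.
Qed.

(* Re-drawing the coordinates in [L] from an independent copy does not change
   the joint law, since both laws agree on cylinders. *)
Lemma decoupling (L : pred K) (Psi : product_space R K -> \bar R) :
  measurable_fun [set: product_space R K] Psi -> (forall h, 0 <= Psi h) ->
  \int[P]_t Psi (X^~ t) =
  \int[P]_t \int[P]_t' Psi (fun k => X k (if L k then t' else t)).
Proof.
move=> mPsi Psi0.
pose z1 (t : T) : product_space R K := X^~ t.
pose z2 (t : T * T) : product_space R K :=
  fun k => X k (if L k then t.2 else t.1).
have mz1 : measurable_fun setT z1 by apply: measurable_to_product_space.
have mz2 : measurable_fun setT z2.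
  apply: measurable_to_product_space => k; rewrite /z2.
  by case: (L k); apply: measurableT_comp.
have mPz2 : measurable_fun setT (Psi \o z2) by exact: measurableT_comp.
transitivity (\int[P \x P]_z (Psi \o z2) z); last first.
  exact: (fubini_tonelli1 (Psi \o z2) mPz2 (fun z => Psi0 (z2 z))).
pose m1 := pushforward P z1; pose m2 := pushforward (P \x P) z2.
transitivity (\int[m1]_h Psi h).
  by rewrite ge0_integral_pushforward.
rewrite -[RHS]/(\int[P \x P]_(z in z2 @^-1` setT) (Psi \o z2) z).
rewrite -ge0_integral_pushforward //.
pose f1 : {mfun T >-> product_space R K} :=
  HB.pack z1 (isMeasurableFun.Build _ _ _ _ _ mz1).
pose f2 : {mfun (T * T)%type >-> product_space R K} :=
  HB.pack z2 (isMeasurableFun.Build _ _ _ _ _ mz2).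
apply: eq_measure_integral => A mA _.
apply: (product_measure_eq (m1 := pushforward P f1) (m2 := pushforward (P \x P) f2)) => //.
  by rewrite /= /pushforward preimage_setT probability_setT ltry.
move=> B mB; rewrite /= /pushforward.
have -> : P (z1 @^-1` cylinder B) = \prod_k P (X k @^-1` B k).
  exact: indep_cylinder.
(* The box [B] is split according to the sample point at which a coordinate is read; its preimage
   under [z2] is then a rectangle in [T * T]. *)
pose BL b := fun k => if L k == b then B k else setT.
have mBL b k : measurable (BL b k) by rewrite /BL; case: ifP.
have -> : z2 @^-1` cylinder B =
    (z1 @^-1` cylinder (BL false)) `*` (z1 @^-1` cylinder (BL true)).
  apply/seteqP; split=> [[t t'] /= H|[t t'] /= [H1 H2] k].
    by split=> k; move: (H k); rewrite /BL /z2; case: (L k).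
  by move: (H1 k) (H2 k); rewrite /BL /z2; case: (L k).
have mz b : measurable (z1 @^-1` cylinder (BL b)).
  rewrite -[X in measurable X]setTI; have := mz1; apply=> //.
  exact: measurable_cylinder.
have Pz b : P (z1 @^-1` cylinder (BL b)) = \prod_k P (X k @^-1` BL b k).
  exact: indep_cylinder.
rewrite product_measure1E //.
transitivity ((\prod_k P (X k @^-1` BL false k)) * \prod_k P (X k @^-1` BL true k));
  last by congr (_ * _); rewrite -Pz.
rewrite -big_split /=.
apply: eq_bigr => k _; rewrite /BL.
by case: (L k); rewrite /= preimage_setT probability_setT ?mul1e ?mule1.
Qed.

End decoupling.

(** * Orthogonal projections *)

Section projection.
Context (R : realType) (n : nat).
Implicit Types (u v w x y : 'rV[R]_n) (V W : 'M[R]_n).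

Definition dot u v : R := \sum_i u 0 i * v 0 i.

Lemma dotE u v : u *m v^T = (dot u v)%:M.
Proof.
apply/matrixP => i j; rewrite !ord1 !mxE eqxx mulr1n.
by apply: eq_bigr => k _; rewrite !mxE.
Qed.

Lemma dotC u v : dot u v = dot v u.
Proof. by apply: eq_bigr => i _; rewrite mulrC. Qed.

Lemma dotDl u v w : dot (u + v) w = dot u w + dot v w.
Proof. by rewrite -big_split; apply: eq_bigr => i _; rewrite mxE mulrDl. Qed.

Lemma dotZl a u w : dot (a *: u) w = a * dot u w.
Proof. by rewrite mulr_sumr; apply: eq_bigr => i _; rewrite mxE mulrA. Qed.

Lemma dotBl u v w : dot (u - v) w = dot u w - dot v w.
Proof. by rewrite dotDl -scaleN1r dotZl mulN1r. Qed.

Lemma dotDr u v w : dot w (u + v) = dot w u + dot w v.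
Proof. by rewrite !(dotC w) dotDl. Qed.

Lemma dotZr a u w : dot w (a *: u) = a * dot w u.
Proof. by rewrite !(dotC w) dotZl. Qed.

Lemma dotBr u v w : dot w (u - v) = dot w u - dot w v.
Proof. by rewrite !(dotC w) dotBl. Qed.

Lemma sqnormE v : sqnorm v = dot v v.
Proof. by apply: eq_bigr => i _; rewrite expr2. Qed.

Lemma dot_eq0 v : dot v v = 0 -> v = 0.
Proof.
move/eqP; rewrite psumr_eq0 => [/allP vv0|i _]; last by rewrite -expr2 sqr_ge0.
apply/rowP => i; rewrite mxE; have := vv0 i (mem_index_enum i).
by rewrite /= mulf_eq0 orbb => /eqP.
Qed.

Definition is_oproj V y v :=
  (v <= V)%MS /\ forall u, (u <= V)%MS -> dot (y - v) u = 0.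

Lemma is_oproj_inj V y v w : is_oproj V y v -> is_oproj V y w -> v = w.
Proof.
move=> [vV yv] [wV yw]; apply/eqP; rewrite -subr_eq0; apply/eqP/dot_eq0.
have vwV : (v - w <= V)%MS by rewrite addmx_sub// eqmx_opp.
have E : v - w = (y - w) - (y - v) by rewrite opprB [RHS]addrC addrA subrK.
by rewrite {1}E dotBl yw// yv// subrr.
Qed.

Lemma oprojE V y v : is_oproj V y v -> oproj V y = v.
Proof.
move=> yv; rewrite /oproj; case: xgetP => [w _ [wV yw]|/(_ v)[]].
  apply: (is_oproj_inj _ yv); split=> // u /yw; rewrite dotE => /matrixP/(_ 0 0).
  by rewrite !mxE eqxx.
by case: yv => vV yv; split=> // u /yv; rewrite dotE => ->; rewrite raddf0.
Qed.

Lemma is_oproj0 y : is_oproj 0 y 0.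
Proof.
split=> [|u]; first exact: sub0mx.
by rewrite submx0 => /eqP->; rewrite /dot big1// => i _; rewrite [X in _ * X]mxE mulr0.
Qed.

(* Also valid for [w = 0], since then the coefficient is [0 / 0 = 0]. *)
Lemma is_oproj_add V y x vy vx : is_oproj V y vy -> is_oproj V x vx ->
  let r := y - vy in let w := x - vx in
  is_oproj (<<x>> + V)%MS y (vy + (dot r w / dot w w) *: w).
Proof.
move=> [vyV yo] [vxV xo] r w; split.
  apply: addmx_sub; first exact: submx_trans vyV (addsmxSr _ _).
  apply/scalemx_sub/addmx_sub; first by rewrite (submx_trans _ (addsmxSl _ _))// genmxE.
  by rewrite eqmx_opp (submx_trans vxV)// addsmxSr.
move=> u /sub_addsmxP[[u1 u2] /= ->].
have u2V : (u2 *m V <= V)%MS by exact: submxMl.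
have [a ->] : exists a, u1 *m <<x>>%MS = a *: x.
  by apply/sub_rVP; rewrite (submx_trans (submxMl _ _))// genmxE.
rewrite opprD addrA -/r dotDr dotZr.
have rV v : (v <= V)%MS -> dot (r - (dot r w / dot w w) *: w) v = 0.
  by move=> vV; rewrite dotBl dotZl (yo _ vV) (xo _ vV) mulr0 subr0.
rewrite (rV _ u2V) addr0 -(subrK vx x) -/w dotDr (rV _ vxV) addr0 dotBl dotZl.
have [ww0|ww0] := eqVneq (dot w w) 0.
  rewrite ww0 mulr0 subr0 (dot_eq0 ww0).
  by rewrite /dot big1 ?mulr0// => i _; rewrite [X in _ * X]mxE mulr0.
by rewrite divfK// subrr mulr0.
Qed.

(** Gram-Schmidt: what is left of [y] once its projection on the span of [s] is removed. It shows
    that projections exist, and it is built from sums, products and inverses only, which later gives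
    measurability. *)
Fixpoint resid (s : seq 'rV[R]_n) y : 'rV[R]_n :=
  if s is x :: s' then
    let w := resid s' x in
    resid s' y - (dot (resid s' y) w / dot w w) *: w
  else y.

Lemma resid_oproj s y : is_oproj (\sum_(x <- s) <<x>>)%MS y (y - resid s y).
Proof.
elim: s y => [|x s IHs] y; first by rewrite big_nil subrr; exact: is_oproj0.
rewrite big_cons /=; have := is_oproj_add (IHs y) (IHs x).
by rewrite !subKr /= opprB addrA addrAC.
Qed.

Lemma is_oproj_eqmx V W y v : (V :=: W)%MS -> is_oproj V y v -> is_oproj W y v.
Proof. by move=> VW [vV yv]; split=> [|u]; rewrite -VW => // /yv. Qed.

Lemma oprojP V y : is_oproj V y (oproj V y).
Proof.
have [v yv] : exists v, is_oproj V y v.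
  pose s := [seq row i V | i <- enum 'I_n].
  exists (y - resid s y); apply: is_oproj_eqmx (resid_oproj s y).
  apply/eqmxP; rewrite big_map big_enum /=; apply/andP; split.
    by apply/sumsmx_subP => i _; rewrite genmxE row_sub.
  by apply/row_subP => i; rewrite (sumsmx_sup i)// genmxE.
by rewrite (oprojE yv).
Qed.

Definition dist2 V y : R := sqnorm (y - oproj V y).

Lemma dist2E V y v : is_oproj V y v -> dist2 V y = dot (y - v) (y - v).
Proof. by move=> yv; rewrite /dist2 (oprojE yv) sqnormE. Qed.

Lemma dist2_resid s y : dist2 (\sum_(x <- s) <<x>>)%MS y = sqnorm (resid s y).
Proof. by rewrite (dist2E (resid_oproj s y)) subKr sqnormE. Qed.

(** Pythagoras: the residual [r] of [y] loses its component along the residual [w] of [x], and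
    [dot r x = dot r w] because [r] is orthogonal to [V]. For [x] in [V] the quotient is 0 / 0 =
    0. *)
Lemma dist2_add V y x :
  dist2 (<<x>> + V)%MS y = dist2 V y - dot (y - oproj V y) x ^+ 2 / dist2 V x.
Proof.
have yo := oprojP V y; have xo := oprojP V x.
rewrite (dist2E (is_oproj_add yo xo)) (dist2E yo) (dist2E xo).
set r := y - oproj V y; set w := x - oproj V x.
have -> : dot r x = dot r w.
  by rewrite /w dotBr [X in _ - X](proj2 yo) ?subr0//; exact: (proj1 xo).
rewrite opprD addrA -/r; clearbody r w; set c := _ / _; rewrite -/c.
rewrite !(dotBl, dotBr, dotZl, dotZr) (dotC w r).
have [ww0|ww0] := eqVneq (dot w w) 0; last by rewrite /c; field.
by rewrite /c ww0 !invr0 !(mulr0, mul0r) !subr0.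
Qed.

End projection.

(** * Givens rotations *)

Section givens.
Context (R : realType) (n : nat).
Implicit Types (u v x y : 'rV[R]_n) (V H : 'M[R]_n) (k l : 'I_n) (c s : R).

Definition givens k l c s : 'M[R]_n := \matrix_(i, j)
  if j == k then (if i == k then c else if i == l then s else 0)
  else if j == l then (if i == k then - s else if i == l then c else 0)
  else (i == j)%:R.

Definition givens_row k l c s (h : 'I_n -> R) : 'I_n -> R := fun j =>
  if j == k then c * h k + s * h l else if j == l then c * h l - s * h k else h j.

Lemma mul_givens p (A : 'M[R]_(p, n)) i k l c s j : k != l ->
  (A *m givens k l c s) i j = givens_row k l c s (A i) j.
Proof.
move=> kl; have lk : l != k by rewrite eq_sym.
rewrite mxE /givens_row; under eq_bigr do rewrite mxE.
have [jk|jk] := eqVneq j k.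
  rewrite ?jk (bigD1 k)//= (bigD1 l)//= eqxx (negPf lk) eqxx big1 ?addr0.
    by rewrite mulrC (mulrC (A i l)).
  by move=> q /andP[/negPf-> /negPf->]; rewrite mulr0.
have [jl|jl] := eqVneq j l.
  rewrite ?jl (bigD1 k)//= (bigD1 l)//= eqxx (negPf lk) eqxx big1 ?addr0.
    by ring.
  by move=> q /andP[/negPf-> /negPf->]; rewrite mulr0.
rewrite (bigD1 j)//= eqxx mulr1 big1 ?addr0// => q /negPf->.
by rewrite mulr0.
Qed.

Lemma dot_givens k l c s u v : k != l -> c ^+ 2 + s ^+ 2 = 1 ->
  dot (u *m givens k l c s) (v *m givens k l c s) = dot u v.
Proof.
move=> kl cs1; have lk : l != k by rewrite eq_sym.
rewrite /dot (bigD1 k)//= (bigD1 l)//= [RHS](bigD1 k)//= [X in _ = _ + X](bigD1 l)//=.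
rewrite !mul_givens// /givens_row !eqxx (negPf lk) !addrA; congr (_ + _).
  have -> : u 0 k * v 0 k + u 0 l * v 0 l =
    (c ^+ 2 + s ^+ 2) * (u 0 k * v 0 k + u 0 l * v 0 l) by rewrite cs1 mul1r.
  by ring.
apply: eq_bigr => j /andP[/negPf jk /negPf jl].
by rewrite !mul_givens// /givens_row jk jl.
Qed.

(** Given by generators, so that invariance of the Gaussian law has to be checked on a single plane
    rotation only. *)
Inductive rotation : 'M[R]_n -> Prop :=
| rotation1 : rotation 1%:M
| rotation_givens k l c s : k != l -> c ^+ 2 + s ^+ 2 = 1 -> rotation (givens k l c s)
| rotationM H1 H2 : rotation H1 -> rotation H2 -> rotation (H1 *m H2).

Lemma dot_rotation H u v : rotation H -> dot (u *m H) (v *m H) = dot u v.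
Proof.
move=> rH; elim: rH u v => [|k l c s kl cs1|H1 H2 _ IH1 _ IH2] u v.
- by rewrite !mulmx1.
- exact: dot_givens.
- by rewrite !mulmxA IH2 IH1.
Qed.

Lemma rotation_mulT H : rotation H -> H *m H^T = 1%:M.
Proof.
move=> rH; apply/matrixP => i j; rewrite !mxE.
transitivity (dot (delta_mx 0 i *m H) (delta_mx 0 j *m H)).
  by rewrite -!rowE; apply: eq_bigr => q _; rewrite !mxE.
rewrite dot_rotation// /dot (bigD1 i)//= !mxE !eqxx mul1r big1 ?addr0//.
by move=> q /negPf qi; rewrite mxE qi andbF mul0r.
Qed.

(** The entries to the right of column [k] are annihilated one at a time by rotations in the planes
    [(k, l)], column [k] absorbing their size. The second clause protects rows treated earlier: a
    row that is zero from column [k] on has nothing to rotate. *)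
Lemma rotation_clear p (A : 'M[R]_(p, n)) (i : 'I_p) (k : 'I_n) :
  exists2 H, rotation H &
    (forall j : 'I_n, (k < j)%N -> (A *m H) i j = 0) /\
    (forall q (B : 'M[R]_(q, n)) i', (forall j : 'I_n, (k <= j)%N -> B i' j = 0) ->
       forall j, (B *m H) i' j = B i' j).
Proof.
suff /(_ n)[H rH [H1 H2]] q0 : exists2 H, rotation H &
    (forall j : 'I_n, (k < j < q0)%N -> (A *m H) i j = 0) /\
    (forall q (B : 'M[R]_(q, n)) i', (forall j : 'I_n, (k <= j)%N -> B i' j = 0) ->
       forall j, (B *m H) i' j = B i' j).
  by exists H => //; split=> // j kj; apply: H1; rewrite kj /=.
elim: q0 => [|q [H rH [IH1 IH2]]].
  exists 1%:M; first exact: rotation1.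
  by split=> [j|q B i' _ j]; rewrite ?ltn0 ?andbF ?mulmx1.
have [nq|qn] := leqP n q.
  exists H => //; split=> // j /andP[kj _]; apply: IH1.
  by rewrite kj (leq_trans _ nq).
have [qk|kq] := leqP q k.
  exists H => //; split=> // j /andP[kj jq]; apply: IH1.
  by rewrite kj ltn_neqAle -ltnS jq andbT; apply: contraTneq kj => ->; rewrite -leqNgt.
pose l := Ordinal qn.
have kl : k != l by apply: contraTneq kq => ->; rewrite /= ltnn.
pose a := (A *m H) i k; pose b := (A *m H) i l.
pose r := Num.sqrt (a ^+ 2 + b ^+ 2).
have r2 : r ^+ 2 = a ^+ 2 + b ^+ 2 by rewrite sqr_sqrtr// addr_ge0// sqr_ge0.
have [r0|r0] := eqVneq r 0.
  exists H => //; split=> // j /andP[kj]; rewrite ltnS leq_eqVlt => /predU1P[jq|jq].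
    have -> : j = l by exact/val_inj.
    have : a ^+ 2 + b ^+ 2 == 0 by rewrite -r2 r0 expr0n.
    by rewrite paddr_eq0 ?sqr_ge0// => /andP[_]; rewrite sqrf_eq0 => /eqP.
  by apply: IH1; rewrite kj.
(* Cosine a / r and sine b / r send the pair (a, b) in columns [k], [l] to (r, 0). *)
have cs1 : (a / r) ^+ 2 + (b / r) ^+ 2 = 1.
  by rewrite !expr_div_n -mulrDl -r2 mulfV// sqrf_eq0.
exists (H *m givens k l (a / r) (b / r)).
  by apply: rotationM => //; exact: rotation_givens.
split=> [j /andP[kj jq]|q' B i' Bi' j].
  rewrite mulmxA mul_givens// /givens_row.
  have -> : (j == k) = false by apply/negbTE; apply: contraTneq kj => ->; rewrite ltnn.
  have [jl|jl] := eqVneq j l.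
    by rewrite -/a -/b; ring.
  apply: IH1; rewrite kj; move: jq; rewrite ltnS leq_eqVlt => /predU1P[jq|//].
  by move/eqP: jl => []; exact/val_inj.
rewrite mulmxA mul_givens// /givens_row !(IH2 _ B i' Bi').
rewrite (Bi' k)// (Bi' l) ?(ltnW kq)// !mulr0 addr0 subr0.
have [->|_] := eqVneq j k; first by rewrite Bi'.
by have [->|//] := eqVneq j l; rewrite (Bi' l)// ltnW.
Qed.

(** An LQ factorisation built row by row: the rows before row q vanish from column q on, so clearing
    row q to the right of the diagonal leaves them alone. *)
Lemma rotation_trig p (A : 'M[R]_(p, n)) : exists2 H, rotation H &
  forall (i : 'I_p) (j : 'I_n), (i < j)%N -> (A *m H) i j = 0.
Proof.
suff /(_ p)[H rH HA] q0 : exists2 H, rotation H &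
    forall (i : 'I_p) (j : 'I_n), (i < q0)%N -> (i < j)%N -> (A *m H) i j = 0.
  by exists H => // i j; exact: HA.
elim: q0 => [|q [H rH IH]]; first by exists 1%:M; [exact: rotation1|].
have [pq|qp] := leqP p q.
  exists H => // i j _; apply: IH; exact: leq_trans (ltn_ord i) pq.
have [nq|qn] := leqP n q.
  exists H => // i j; rewrite ltnS leq_eqVlt => /predU1P[iq|iq] ij; last exact: IH.
  by have := leq_trans (ltn_ord j) nq; rewrite -iq ltnNge (ltnW ij).
have [H' rH' [H1 H2]] := rotation_clear (A *m H) (Ordinal qp) (Ordinal qn).
exists (H *m H'); first exact: rotationM.
move=> i j; rewrite ltnS leq_eqVlt mulmxA => /predU1P[iq|iq] ij.
  have -> : i = Ordinal qp by exact/val_inj.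
  by apply: H1; rewrite /= -iq.
rewrite H2 => [|j' /= qj']; first exact: IH.
by apply: IH => //; exact: leq_trans iq qj'.
Qed.

Definition adapted_rotation V y H :=
  [/\ forall v, (v <= V)%MS -> forall j : 'I_n, (\rank V <= j)%N -> (v *m H) 0 j = 0,
      forall u, (forall j : 'I_n, (\rank V <= j)%N -> u 0 j = 0) -> (u *m H^T <= V)%MS &
      forall j : 'I_n, (\rank V < j)%N -> (y *m H) 0 j = 0].

(** A basis of [V] stacked over [y] is made lower triangular. This puts the image of [V] inside the
    span of the first [\rank V] coordinate vectors, and the two are equal since their ranks
    agree. *)
Lemma adapted_rotation_exists V y : exists2 H, rotation H & adapted_rotation V y H.
Proof.
pose A := col_mx (row_base V) y.
have [H rH HA] := rotation_trig A; exists H => //.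
have HV v : (v <= V)%MS -> forall j : 'I_n, (\rank V <= j)%N -> (v *m H) 0 j = 0.
  rewrite -(eq_row_base V) => /submxP[B ->] j Vj.
  rewrite -mulmxA mxE big1// => i _.
  have := HA (lshift 1 i) j; rewrite /A mul_col_mx col_mxEu => ->; first by rewrite mulr0.
  exact: leq_trans (ltn_ord i) Vj.
split=> // [u uj|j Vj]; last first.
  by have := HA (rshift (\rank V) 0) j; rewrite /A mul_col_mx col_mxEd /= addn0; apply.
have HHT := rotation_mulT rH; have HTH := mulmx1C HHT.
have fH : row_free H by apply/row_freeP; exists H^T.
have VHE : (V *m H <= (pid_mx (\rank V) : 'M[R]_n))%MS.
  apply/row_subP => i; rewrite row_mul.
  have /HV rj := row_sub i V.
  suff -> : row i V *m H = row i V *m H *m pid_mx (\rank V) by exact: submxMl.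
  apply/rowP => j; rewrite [RHS]mxE (bigD1 j)//= big1 ?addr0 => [|q qj].
    rewrite [X in _ * X]mxE eqxx /=; have [jV|Vj] := ltnP j (\rank V); first by rewrite mulr1.
    by rewrite mulr0 rj.
  by rewrite [X in _ * X]mxE (_ : (q == j :> nat) = (q == j))// (negPf qj) mulr0.
have EV : ((pid_mx (\rank V) : 'M[R]_n) <= V *m H)%MS.
  have := mxrank_leqif_sup VHE; rewrite mxrankMfree// => /leqifP.
  rewrite rank_pid_mx ?rank_leq_row//; case: ifP => // _.
  by rewrite ltnn.
have uE : (u <= V *m H)%MS.
  apply: submx_trans EV.
  suff -> : u = u *m pid_mx (\rank V) by exact: submxMl.
  apply/rowP => j; rewrite [RHS]mxE (bigD1 j)//= big1 ?addr0 => [|q qj].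
    rewrite [X in _ * X]mxE eqxx /=; have [jV|Vj] := ltnP j (\rank V); first by rewrite mulr1.
    by rewrite mulr0 uj.
  by rewrite [X in _ * X]mxE (_ : (q == j :> nat) = (q == j))// (negPf qj) mulr0.
by have := submxMr H^T uE; rewrite -mulmxA HHT mulmx1.
Qed.

Section adapted.
Variables (V : 'M[R]_n) (y : 'rV[R]_n) (H : 'M[R]_n).
Hypothesis (rH : rotation H) (aH : adapted_rotation V y H).

Definition head_part x : 'rV[R]_n :=
  \row_j (if (j < \rank V)%N then (x *m H) 0 j else 0).

Lemma is_oproj_adapted x : is_oproj V x (head_part x *m H^T).
Proof.
case: aH => [HV VH _]; split.
  by apply: VH => j Vj; rewrite mxE ltnNge Vj.
move=> u uV; rewrite -(dot_rotation _ _ rH) mulmxBl -mulmxA.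
rewrite (mulmx1C (rotation_mulT rH)) mulmx1 /dot big1// => j _.
rewrite [X in X * _]mxE [X in _ + X]mxE [X in - X]mxE.
have [jV|Vj] := ltnP j (\rank V); first by rewrite subrr mul0r.
by rewrite (HV u uV j Vj) mulr0.
Qed.

Lemma dot_adapted x u :
  dot (x - oproj V x) u = \sum_(j < n | (\rank V <= j)%N) (x *m H) 0 j * (u *m H) 0 j.
Proof.
rewrite (oprojE (is_oproj_adapted x)) -(dot_rotation _ _ rH) mulmxBl -mulmxA.
rewrite (mulmx1C (rotation_mulT rH)) mulmx1 /dot [RHS]big_mkcond /=; apply: eq_bigr => j _.
rewrite [X in X * _]mxE [X in _ + X]mxE [X in - X]mxE.
by have [jV|Vj] := ltnP j (\rank V); rewrite ?subrr ?mul0r ?subr0.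
Qed.

Lemma dist2_adapted x :
  dist2 V x = \sum_(j < n | (\rank V <= j)%N) (x *m H) 0 j ^+ 2.
Proof.
rewrite (dist2E (oprojP V x)) dotBr [X in _ - X](proj2 (oprojP V x)); last exact: (proj1 (oprojP V x)).
by rewrite subr0 dot_adapted; apply: eq_bigr => j _; rewrite expr2.
Qed.

Variable m : 'I_n.
Hypothesis Vm : \rank V = m.

Lemma dist2_adapted_y : dist2 V y = (y *m H) 0 m ^+ 2.
Proof.
case: aH => [_ _ Hy]; rewrite dist2_adapted (bigD1 m) ?Vm//= big1 ?addr0// => j /andP[mj jm].
by rewrite Hy ?expr0n// Vm ltn_neqAle mj andbT eq_sym.
Qed.

(** After rotation the residual of [y] has the single nonzero coordinate [m], so its scalar product
    with [x] is one product of coordinates, and the square of that product contains [dist2 V y] as a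
    factor. *)
Lemma dist2_adapted_add x :
  dist2 (<<x>> + V)%MS y = dist2 V y -
    dist2 V y * (x *m H) 0 m ^+ 2 / \sum_(j < n | (m <= j)%N) (x *m H) 0 j ^+ 2.
Proof.
rewrite dist2_add [dist2 V x]dist2_adapted Vm; congr (_ - _ / _).
rewrite dist2_adapted_y -exprMn; congr (_ ^+ 2).
case: aH => [_ _ Hy]; rewrite dot_adapted (bigD1 m) ?Vm//= big1 ?addr0// => j /andP[mj jm].
by rewrite Hy ?mul0r// Vm ltn_neqAle mj andbT eq_sym.
Qed.

End adapted.
End givens.

(** * Substitution and Tonelli on the line *)

Section affine_substitution.
Context (R : realType).
Local Notation mu := (@lebesgue_measure R).
Implicit Types (a b : R) (h : R -> \bar R).

Lemma measurable_affine a b : measurable_fun [set: R] (fun x => a * x + b).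
Proof. by apply: measurable_funD => //; exact: mulrl_measurable. Qed.

(** Uniqueness of Lebesgue measure: the pushforward under the affine map, scaled by [a], gives
    half-open intervals their length. *)
Lemma lebesgue_measure_affine a b (A : set R) : 0 < a -> measurable A ->
  mu ((fun x => a * x + b) @^-1` A) = (a^-1%:E * mu A)%E.
Proof.
move=> a0 mA; pose f : measurableTypeR R -> measurableTypeR R := fun x => a * x + b.
have mf : measurable_fun (setT : set (measurableTypeR R)) f := measurable_affine a b.
pose m := measure_function_pushforward__canonical__measure_function_Measure mu mf.
pose a' : {nonneg R} := NngNum (ltW a0).
suff -> : mu A = (a%:E * mu (f @^-1` A))%E.
  by rewrite muleA -EFinM mulVf ?gt_eqF// mul1e.
transitivity (mscale a' m A) => //.
apply: lebesgue_measure_unique => // _ [[u v] _ <-] /=.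
rewrite /mscale /= /pushforward.
have -> : f @^-1` `]u, v] = `](u - b) / a, (v - b) / a]%classic.
  apply/seteqP; split=> x /=; rewrite !in_itv /= /f ltr_pdivrMr// ler_pdivlMr//.
    by move=> /andP[? ?]; apply/andP; split; lra.
  by move=> /andP[? ?]; apply/andP; split; lra.
rewrite !lebesgue_measure_itv /= !lte_fin ltr_pM2r ?invr_gt0// ltrD2r.
case: ifP => // _; last by rewrite mule0.
by rewrite -EFinM -!EFinD; congr EFin; field; rewrite gt_eqF.
Qed.

Lemma integral_affine_pos a b h : 0 < a -> measurable_fun setT h ->
  (forall x, (0 <= h x)%E) ->
  (\int[mu]_x h (a * x + b)%R = a^-1%:E * \int[mu]_x h x)%E.
Proof.
move=> a0 mh h0; pose f : measurableTypeR R -> measurableTypeR R := fun x => a * x + b.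
have mf : measurable_fun (setT : set (measurableTypeR R)) f := measurable_affine a b.
have a0' : 0 <= a^-1 by rewrite invr_ge0 ltW.
rewrite -[LHS]/(\int[mu]_(x in f @^-1` setT) (h \o f) x)%E.
rewrite -ge0_integral_pushforward//.
rewrite -(ge0_integral_mscale mu measurableT (NngNum a0')) //.
by apply: eq_measure_integral => A mA _; exact: lebesgue_measure_affine.
Qed.

Lemma ge0_integral_opp h : measurable_fun setT h -> (forall x, (0 <= h x)%E) ->
  (\int[mu]_x h (- x)%R = \int[mu]_x h x)%E.
Proof.
move=> mh h0; pose f : measurableTypeR R -> measurableTypeR R := -%R.
have mf : measurable_fun (setT : set (measurableTypeR R)) f.
  exact: (@oppr_measurable R).
rewrite -[LHS]/(\int[mu]_(x in f @^-1` setT) (h \o f) x)%E.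
rewrite -ge0_integral_pushforward//.
by apply: eq_measure_integral => A mA _; exact: lebesgue_measureN.
Qed.

Lemma integral_affine a b h : a != 0 -> measurable_fun setT h ->
  (forall x, (0 <= h x)%E) ->
  (\int[mu]_x h (a * x + b)%R = `|a|^-1%:E * \int[mu]_x h x)%E.
Proof.
move=> a0 mh h0; case: (ltrgtP a 0) => [an|ap|/eqP]; last by rewrite (negPf a0).
  rewrite -ge0_integral_opp; last 2 first.
  - exact: (measurableT_comp mh (measurable_affine a b)).
  - by move=> x; exact: h0.
  under eq_integral do rewrite mulrN -mulNr.
  by rewrite integral_affine_pos ?oppr_gt0// ltr0_norm.
by rewrite integral_affine_pos// gtr0_norm.
Qed.

End affine_substitution.

(** * Measures with a density *)

Section density.
Local Open Scope ereal_scope.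
Context d (T : measurableType d) (R : realType) (m : {measure set T -> \bar R}).
Variable g : T -> R.
Hypothesis mg : measurable_fun [set: T] g.
Hypothesis g0 : forall x, (0 <= g x)%R.

Definition density (A : set T) : \bar R := \int[m]_(x in A) (g x)%:E.

Let density0 : density set0 = 0.
Proof. exact: integral_set0. Qed.

Let density_ge0 A : 0 <= density A.
Proof. by apply: integral_ge0 => x _; rewrite lee_fin. Qed.

Let density_sigma_additive : semi_sigma_additive density.
Proof.
move=> F mF tF mUF; rewrite /density ge0_integral_bigcup//.
  by apply: is_cvg_ereal_nneg_natsum_cond => n _ _; apply: integral_ge0 => x _; rewrite lee_fin.
- exact/measurable_EFinP/measurable_funTS.
- by move=> x _; rewrite lee_fin.
Qed.

HB.instance Definition _ := isMeasure.Build _ _ _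
  density density0 density_ge0 density_sigma_additive.

Definition density_measure : {measure set T -> \bar R} := density.

Import HBNNSimple.

(** Simple functions and monotone convergence. [nu] only has to agree with the density on measurable
    sets, so the rule also serves a measure defined elsewhere, such as [normal_prob]. *)
Lemma ge0_integral_density (nu : {measure set T -> \bar R}) (f : T -> \bar R) :
  (forall A, measurable A -> nu A = \int[m]_(x in A) (g x)%:E) ->
  measurable_fun [set: T] f -> (forall x, 0 <= f x) ->
  \int[nu]_x f x = \int[m]_x (f x * (g x)%:E).
Proof.
move=> nuE mf f0; pose f_ := nnsfun_approx measurableT mf.
transitivity (limn (fun n => \int[nu]_x (f_ n x)%:E)).
  rewrite -monotone_convergence//.
  - by apply: eq_integral => y _; apply/esym/cvg_lim => //; exact: cvg_nnsfun_approx.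
  - by move=> n; exact/measurable_EFinP/measurable_funP.
  - by move=> n y _; rewrite lee_fin.
  - by move=> y _ i j ij; rewrite lee_fin; exact/lefP/nd_nnsfun_approx.
transitivity (limn (fun n => \int[m]_x ((f_ n x)%:E * (g x)%:E))); last first.
  rewrite -monotone_convergence//.
  - apply: eq_integral => y _; apply/cvg_lim => //.
    by apply: cvgeZr => //; exact: cvg_nnsfun_approx.
  - by move=> n; apply: emeasurable_funM; exact/measurable_EFinP.
  - by move=> n y _; rewrite mule_ge0// lee_fin.
  - move=> y _ i j ij; apply: lee_wpmul2r; first by rewrite lee_fin.
    by rewrite lee_fin; exact/lefP/nd_nnsfun_approx.
congr (limn _); apply/funext => n.
transitivity (\sum_(k \in range (f_ n))
    \int[nu]_x (k * \1_(f_ n @^-1` [set k]) x)%:E).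
  under eq_integral do rewrite fimfunE -fsumEFin//.
  rewrite ge0_integral_fsum//.
  - by move=> y; exact/measurable_EFinP/measurable_funM.
  - by move=> y x _; rewrite nnfun_muleindic_ge0.
transitivity (\sum_(k \in range (f_ n))
    \int[m]_x ((k * \1_(f_ n @^-1` [set k]) x)%:E * (g x)%:E)); last first.
  rewrite -ge0_integral_fsum//.
  - apply: eq_integral => x _; rewrite [in RHS]fimfunE -fsumEFin//.
    rewrite ge0_mule_fsuml// => k; exact: nnfun_muleindic_ge0.
  - move=> r; by apply: emeasurable_funM; apply/measurable_EFinP => //; exact: measurable_funM.
  - by move=> r x _; rewrite mule_ge0 ?nnfun_muleindic_ge0// lee_fin.
apply: eq_fsbigr => r _; rewrite integralZl_indic_nnsfun// integral_indic//= setIT nuE//.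
have [r0|r0] := ltP r 0%R.
  rewrite preimage_nnfun0// integral_set0 mule0.
  by under eq_integral do rewrite indic0 mulr0 mul0e; rewrite integral0.
under [RHS]eq_integral do rewrite EFinM -muleA.
rewrite ge0_integralZl//.
- by rewrite integral_mkcond; congr (_ * _); apply: eq_integral => x _; rewrite epatch_indic muleC.
- by apply: emeasurable_funM; exact/measurable_EFinP.
- by move=> x _; rewrite mule_ge0// lee_fin.
Qed.

End density.

Ltac measurability_tac := repeat lazymatch goal with
  | H : ?G |- ?G => exact H
  | |- measurable_fun _ (fun _ => ?c) => exact: measurable_cst
  | |- measurable_fun _ (fun z => z) => exact: measurable_id
  | |- measurable_fun _ (fun z => fst z) => exact: measurable_fst
  | |- measurable_fun _ (fun z => snd z) => exact: measurable_snd
  | |- measurable_fun _ fst => exact: measurable_fst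
  | |- measurable_fun _ snd => exact: measurable_snd
  | |- measurable_fun _ (fun z => (@?f z + - @?g z)%R) =>
      apply: (@measurable_funB _ _ _ _ f g)
  | |- measurable_fun _ (fun z => (@?f z + @?g z)%R) =>
      apply: (@measurable_funD _ _ _ _ f g)
  | |- measurable_fun _ (fun z => (@?f z * @?g z)%R) =>
      apply: (@measurable_funM _ _ _ _ f g)
  | |- measurable_fun _ (fun z => (@?f z ^+ _)%R) =>
      apply: (@measurable_funX _ _ _ _ f)
  | |- measurable_fun _ (fun z => (@?f z * @?g z)%E) =>
      apply: (@emeasurable_funM _ _ _ _ f g)
  | |- measurable_fun _ (fun z => EFin (@?f z)) =>
      apply/(@measurable_EFinP _ _ _ _ f)
  end.

(** * Iterated integrals and rotations of the plane *)

Section tonelli.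
Local Open Scope ereal_scope.
Context (R : realType).
Local Notation mu := (@lebesgue_measure R).

Lemma measurable_fun2_comp d (T : measurableType d) d1 (T1 : measurableType d1)
    d2 (T2 : measurableType d2) (F : T1 -> T2 -> \bar R) (f : T -> T1) (g : T -> T2) :
  measurable_fun [set: T1 * T2] (fun z => F z.1 z.2) ->
  measurable_fun setT f -> measurable_fun setT g ->
  measurable_fun setT (fun t => F (f t) (g t)).
Proof.
move=> mF mf mg.
apply: (measurableT_comp (f := fun z : T1 * T2 => F z.1 z.2) (g := fun t => (f t, g t))) => //.
exact: measurable_fun_pair.
Qed.

Context d (T : measurableType d).
Variable F : T -> R -> \bar R.
Hypothesis mF : measurable_fun [set: T * R] (fun z => F z.1 z.2).
Hypothesis F0 : forall x y, 0 <= F x y.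

Lemma measurable_integral2 : measurable_fun setT (fun x => \int[mu]_y F x y).
Proof.
exact: (measurable_fun_fubini_tonelli_F (m2 := mu) (fun z : T * measurableTypeR R => F z.1 z.2)).
Qed.

Lemma tonelli_swap (m : {sigma_finite_measure set T -> \bar R}) :
  \int[m]_x \int[mu]_y F x y = \int[mu]_y \int[m]_x F x y.
Proof.
exact: (fubini_tonelli (m1 := m) (m2 := mu) (fun z : T * measurableTypeR R => F z.1 z.2)).
Qed.

End tonelli.

Section lebesgue2.
Local Open Scope ereal_scope.
Context (R : realType).
Local Notation mu := (@lebesgue_measure R).

Lemma tonelli_lebesgue (F : R -> R -> \bar R) :
  measurable_fun [set: R * R] (fun z => F z.1 z.2) -> (forall x y, 0 <= F x y) ->
  \int[mu]_x \int[mu]_y F x y = \int[mu]_y \int[mu]_x F x y.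
Proof.
move=> mF F0.
by apply: (@tonelli_swap R _ (measurableTypeR R) F) => //.
Qed.

Lemma integral_shift (b : R) (h : R -> \bar R) : measurable_fun setT h ->
  (forall x, 0 <= h x) -> \int[mu]_x h (x + b)%R = \int[mu]_x h x.
Proof.
move=> mh h0; have := integral_affine_pos b ltr01 mh h0.
by rewrite invr1 mul1e => <-; apply: eq_integral => x _; rewrite mul1r.
Qed.

Lemma integral_affine_rev (a b : R) (h : R -> \bar R) : (0 < a)%R ->
  measurable_fun setT h -> (forall x, 0 <= h x) ->
  \int[mu]_x h x = \int[mu]_x (a%:E * h (a * x + b)%R).
Proof.
move=> a0 mh h0.
have a0' : (a != 0)%R by rewrite gt_eqF.
rewrite ge0_integralZl// ?lee_fin ?(ltW a0)//; last first.
  exact: (measurableT_comp mh (measurable_affine a b)).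
by rewrite integral_affine_pos// muleA -EFinM mulfV// mul1e.
Qed.

(** With y fixed, u = c x + s y turns the second argument into (y - s u) / c; with u fixed, that
    argument becomes the second variable. The Jacobians 1 / |c| and |c| cancel. *)
Lemma integral_rotation (c s : R) (F : R -> R -> \bar R) : (c ^+ 2 + s ^+ 2 = 1)%R ->
  measurable_fun [set: R * R] (fun z => F z.1 z.2) -> (forall x y, 0 <= F x y) ->
  \int[mu]_x \int[mu]_y F (c * x + s * y)%R (c * y - s * x)%R =
  \int[mu]_x \int[mu]_y F x y.
Proof.
move=> cs1 mF F0.
have mF1 x : measurable_fun [set: R] (F x).
  by apply: (measurable_fun2_comp mF).
have mF2 y : measurable_fun [set: R] (F ^~ y).
  by apply: (measurable_fun2_comp (F := F) mF).
(* For c = 0 the rotation exchanges the two coordinates up to signs, and the substitution through 1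
   / c is replaced by Tonelli. *)
have [c0|c0] := eqVneq c 0%R.
  have s1 : (`|s| = 1)%R.
    by apply/eqP; rewrite -sqrp_eq1// real_normK ?num_real// -cs1 c0 expr0n add0r.
  have s0 : (s != 0)%R by rewrite -normr_eq0 s1 oner_eq0.
  transitivity (\int[mu]_x \int[mu]_y F y (- s * x + 0)%R).
    apply: eq_integral => x _.
    transitivity (\int[mu]_y F (s * y + 0)%R (- s * x + 0)%R).
      by apply: eq_integral => y _; congr F; rewrite c0; ring.
    by rewrite (integral_affine _ (h := F ^~ (- s * x + 0)%R))// s1 invr1 mul1e.
  have mG : measurable_fun [set: R * R] (fun z : R * R => F z.2 (- s * z.1 + 0)%R).
    by apply: (measurable_fun2_comp mF); measurability_tac.
  rewrite (tonelli_lebesgue mG (fun x y => F0 _ _)).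
  apply: eq_integral => y _.
  by rewrite (integral_affine _ (h := F y)) ?oppr_eq0// normrN s1 invr1 mul1e.
have mG : measurable_fun [set: R * R]
    (fun z : R * R => F (c * z.1 + s * z.2)%R (c * z.2 - s * z.1)%R).
  by apply: (measurable_fun2_comp mF); measurability_tac.
rewrite (tonelli_lebesgue mG (fun x y => F0 _ _)).
have mH : measurable_fun [set: R * R] (fun z : R * R => F z.1 ((z.2 - s * z.1) / c)%R).
  by apply: (measurable_fun2_comp mF); measurability_tac.
transitivity (\int[mu]_y (`|c|^-1%:E * \int[mu]_u F u ((y - s * u) / c)%R)).
  apply: eq_integral => y _.
  have mHy : measurable_fun [set: R] (fun u => F u ((y - s * u) / c)%R).
    by apply: (measurable_fun2_comp mF); measurability_tac.
  rewrite -(integral_affine (s * y) c0 mHy (fun u => F0 _ _)).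
  apply: eq_integral => x _; congr F.
  have -> : (y - s * (c * x + s * y) = (1 - s ^+ 2) * y - s * c * x)%R by ring.
  by rewrite -cs1 addrK; field.
have mH' : measurable_fun [set: R * R] (fun z : R * R => F z.2 ((z.1 - s * z.2) / c)%R).
  by apply: (measurable_fun2_comp mF); measurability_tac.
rewrite ge0_integralZl//; last 2 first.
- exact: (measurable_integral2 mH' (fun y u => F0 _ _)).
- by move=> y _; exact: integral_ge0.
transitivity (`|c|^-1%:E * \int[mu]_u \int[mu]_y F u ((y - s * u) / c)%R).
  congr (_ * _); apply/esym.
  exact: (tonelli_lebesgue (F := fun u y => F u ((y - s * u) / c)%R) mH).
transitivity (`|c|^-1%:E * \int[mu]_x (`|c|%:E * \int[mu]_y F x y)).
  congr (_ * _); apply: eq_integral => u _.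
  transitivity (\int[mu]_y F u (c^-1 * y + (- (s * u) / c))%R).
    by apply: eq_integral => y _; congr F; field.
  by rewrite (integral_affine _ (h := F u)) ?invr_eq0// normfV invrK.
rewrite ge0_integralZl//; last 2 first.
- exact: measurable_integral2.
- by move=> y _; exact: integral_ge0.
by rewrite muleA -EFinM mulVf ?normr_eq0// mul1e.
Qed.

End lebesgue2.

(** * Gamma and beta densities *)

Section log_substitution.
Context (R : realType).
Local Notation mu := (@lebesgue_measure R).

(** Rewriting through a real power of x^2 keeps the base nonnegative; the formula also holds at 0,
    where both sides are 0. *)
Lemma measurable_inv : measurable_fun [set: R] (fun x : R => x^-1).
Proof.
have -> : (fun x : R => x^-1) = (fun x => x * (x ^+ 2) `^ (-1)).
  apply/funext => x; rewrite powR_inv1 ?sqr_ge0//.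
  have [->|x0] := eqVneq x 0; first by rewrite invr0 mul0r.
  by field.
apply: measurable_funM => //.
apply: (measurableT_comp (f := fun y : R => y `^ (-1)) (g := fun x : R => x ^+ 2)).
  exact: measurable_powR.
exact: measurable_funX.
Qed.

(** The density of dx / x on the positive half-line, the measure that [ln] carries to Lebesgue
    measure. *)
Definition pos_inv (x : R) : R := if 0 < x then x^-1 else 0.

Lemma measurable_gt0 : measurable_fun [set: R] (fun x : R => 0 < x).
Proof. exact: measurable_fun_ltr. Qed.

Lemma measurable_pos_inv : measurable_fun [set: R] pos_inv.
Proof.
apply: measurable_fun_ifT => //; [exact: measurable_gt0 | exact: measurable_inv].
Qed.

Lemma pos_inv_ge0 x : 0 <= pos_inv x.
Proof. by rewrite /pos_inv; case: ifP => // x0; rewrite invr_ge0 ltW. Qed.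

Lemma integral_pos_inv (a b : R) :
  (\int[mu]_(x in @ln R @^-1` `]a, b]) (pos_inv x)%:E = mu `]a, b])%E.
Proof.
rewrite lebesgue_measure_itv /= lte_fin.
have [ab|ba] := ltP a b; last first.
  by rewrite set_itv_ge ?bnd_simp -?leNgt// preimage_set0 integral_set0.
transitivity (\int[mu]_(x in `]expR a, expR b]) (x^-1)%:E)%E.
  rewrite integral_mkcond [RHS]integral_mkcond; apply: eq_integral => x _.
  rewrite !patchE /pos_inv.
  (* The default value of [ln] may put nonpositive points in the preimage, but [pos_inv] vanishes
     there. *)
  have [x0|x0] := ltP 0 x; last first.
    rewrite [X in _ = if X then _ else _]memNset; first by case: ifP.
    by rewrite /= in_itv /= => /andP[/(lt_trans (expR_gt0 a))]; rewrite ltNge x0.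
  congr (if _ then _ else _); apply/idP/idP; rewrite !inE /= !in_itv /=.
    move=> /andP[? ?]; rewrite -[x in _ < x]lnK ?posrE// ltr_expR.
    by rewrite -[x in x <= _]lnK ?posrE// ler_expR; apply/andP.
  move=> /andP[? ?]; rewrite -ltr_expR -ler_expR !lnK ?posrE//; exact/andP.
have ab' : expR a < expR b by rewrite ltr_expR.
rewrite integral_itv_obnd_cbnd; last first.
  by apply/measurable_EFinP/measurable_funTS; exact: measurable_inv.
rewrite (@continuous_FTC2 _ (fun x => x^-1) (@ln R)) ?expRK//.
- apply: continuous_in_subspaceT => x; rewrite inE /= in_itv /= => /andP[ax _].
  by apply: inv_continuous; rewrite gt_eqF// (lt_le_trans _ ax)// expR_gt0.
- have dln x : 0 < x -> derivable (@ln R) x 1 by move=> /is_derive1_ln[].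
  split.
  + by move=> x /[!in_itv]/= /andP[ax _]; apply: dln; rewrite (lt_trans _ ax)// expR_gt0.
  + by apply: cvg_at_right_filter; apply: continuous_ln; exact: expR_gt0.
  + by apply: cvg_at_left_filter; apply: continuous_ln; exact: expR_gt0.
- move=> x /[!in_itv]/= /andP[ax _]; have x0 : 0 < x by rewrite (lt_trans _ ax)// expR_gt0.
  by rewrite derive1E; case: (is_derive1_ln x0).
Qed.

Lemma lebesgue_measure_ln (A : set R) : measurable A ->
  mu A = (\int[mu]_(x in @ln R @^-1` A) (pos_inv x)%:E)%E.
Proof.
move=> mA.
pose f : measurableTypeR R -> measurableTypeR R := @ln R.
have mf : measurable_fun (setT : set (measurableTypeR R)) f := @measurable_ln R.
pose nu := density_measure mu measurable_pos_inv pos_inv_ge0.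
pose m := measure_function_pushforward__canonical__measure_function_Measure nu mf.
transitivity (m A) => //.
apply: lebesgue_measure_unique => // _ [[a b] _ <-] /=.
by rewrite -integral_pos_inv.
Qed.

(** In the variable s = ln x squaring is doubling, so the substitution u = x^2 / 2 needs nothing
    beyond this rule and the affine one. *)
Lemma integral_ln (H : R -> \bar R) : measurable_fun setT H ->
  (forall x, (0 <= H x)%E) ->
  (\int[mu]_s H s = \int[mu]_x (H (ln x) * (pos_inv x)%:E))%E.
Proof.
move=> mH H0.
pose f : measurableTypeR R -> measurableTypeR R := @ln R.
have mf : measurable_fun (setT : set (measurableTypeR R)) f := @measurable_ln R.
pose nu := density_measure mu measurable_pos_inv pos_inv_ge0.
transitivity (\int[pushforward nu f]_s H s)%E.
  by apply: eq_measure_integral => A mA _; exact: lebesgue_measure_ln.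
rewrite ge0_integral_pushforward// preimage_setT.
rewrite (@ge0_integral_density _ (measurableTypeR R) R mu pos_inv measurable_pos_inv
  pos_inv_ge0 nu)//.
- exact: (measurableT_comp mH mf).
- by move=> x; exact: H0.
Qed.

End log_substitution.

Section gamma_beta.
Context (R : realType).
Local Notation mu := (@lebesgue_measure R).

(** Unnormalised, and extended by 0 to the whole line so that substitutions carry no integration
    domain; likewise for [beta_dens01]. *)
Definition gamma_dens (a u : R) : R := if 0 < u then u `^ (a - 1) * expR (- u) else 0.

Definition beta_dens01 (a b u : R) : R :=
  if (0 < u) && (u < 1) then beta_dens a b u else 0.

Lemma gamma_dens_ge0 a u : 0 <= gamma_dens a u.
Proof. by rewrite /gamma_dens; case: ifP => // _; rewrite mulr_ge0 ?powR_ge0 ?expR_ge0. Qed.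

Lemma beta_dens01_ge0 a b u : 0 <= beta_dens01 a b u.
Proof. by rewrite /beta_dens01; case: ifP => // _; rewrite mulr_ge0 ?powR_ge0. Qed.

Lemma measurable_powR_comp d (T : measurableType d) (f : T -> R) a :
  measurable_fun setT f -> measurable_fun setT (fun t => f t `^ a).
Proof.
by move=> mf; apply: (measurableT_comp (f := fun y : R => y `^ a) (g := f)).
Qed.

Lemma measurable_gamma_dens a : measurable_fun [set: R] (gamma_dens a).
Proof.
apply: measurable_fun_ifT; [exact: measurable_gt0| |exact: measurable_cst].
apply: measurable_funM; first exact: measurable_powR.
by apply: measurableT_comp => //; exact: oppr_measurable.
Qed.

Lemma measurable_beta_dens01 a b : measurable_fun [set: R] (beta_dens01 a b).
Proof.
apply: measurable_fun_ifT => //.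
  by apply: measurable_and; exact: measurable_fun_ltr.
apply: measurable_funM; apply: measurable_powR_comp; measurability_tac.
Qed.

Local Open Scope ereal_scope.

Lemma integral_even (phi : R -> \bar R) : measurable_fun setT phi ->
  (forall x, 0 <= phi x) -> (forall x, phi (- x)%R = phi x) ->
  \int[mu]_x phi x = 2%:E * \int[mu]_x (phi x * (0 < x)%R%:R%:E).
Proof.
move=> mphi phi0 even.
pose p (x : R) : \bar R := (0 < x)%R%:R%:E.
have p0 x : 0 <= p x by rewrite lee_fin.
have mp : measurable_fun [set: R] p.
  apply/measurable_EFinP.
  rewrite [X in measurable_fun _ X](_ : _ = fun x : R => if (0 < x)%R then 1%R else 0%R).
    by apply: measurable_fun_ifT => //; exact: measurable_gt0.
  by apply/funext => x; case: ifP.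
have mpN : measurable_fun [set: R] (fun x : R => p (- x)%R).
  apply: (measurableT_comp (f := p) (g := fun x : R => (- x)%R)) => //.
  exact: oppr_measurable.
(* The two open half-lines miss the origin, hence an equality almost everywhere only. *)
transitivity (\int[mu]_x (phi x * p x + phi x * p (- x)%R)).
  apply: ge0_ae_eq_integral => //.
  - by apply: emeasurable_funD; exact: emeasurable_funM.
  - by move=> x _; rewrite adde_ge0// mule_ge0.
  - exists [set 0%R]; split; [exact: measurable_set1|exact: lebesgue_measure_set1|].
    move=> x /=; apply: contra_notP => /eqP x0 _; rewrite /p oppr_gt0.
    by case: ltgtP x0 => //= _ _; rewrite mule1 mule0 ?add0e ?adde0.
rewrite ge0_integralD//; last 4 first.
- by move=> x _; rewrite mule_ge0.
- exact: emeasurable_funM.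
- by move=> x _; rewrite mule_ge0.
- exact: emeasurable_funM.
rewrite -[X in _ + X]ge0_integral_opp; last 2 first.
- exact: emeasurable_funM.
- by move=> x; rewrite mule_ge0.
under [X in _ + X]eq_integral do rewrite even opprK.
by rewrite (_ : 2%R = 1 + 1)%R// EFinD ge0_muleDl// mul1e.
Qed.

Lemma normal_square_law : exists2 c : \bar R, 0 <= c &
  forall f : R -> \bar R, measurable_fun setT f -> (forall u, 0 <= f u) ->
  \int[normal_prob 0 1]_x f (x ^+ 2 / 2)%R =
  c * \int[mu]_u (f u * (gamma_dens 2^-1 u)%:E).
Proof.
pose C : R := normal_peak (1 : R).
have C0 : (0 <= C)%R by exact: normal_peak_ge0.
(* The factor 2 comes from evenness, [2^-1 * expR (ln 2 / 2)] from writing x = exp ((r + ln 2) / 2),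
   and [C] is the peak of the normal density. *)
exists (2 * (2^-1 * expR (ln 2 / 2) * C)%:E).
  by rewrite mule_ge0// lee_fin !mulr_ge0 ?expR_ge0.
move=> f mf f0.
pose k (u : R) : \bar R := f u * (C * expR (- u))%:E.
have k0 u : 0 <= k u by rewrite mule_ge0// lee_fin mulr_ge0// expR_ge0.
have mk : measurable_fun [set: R] k.
  apply: emeasurable_funM => //; apply/measurable_EFinP/measurable_funM => //.
  by apply: measurableT_comp => //; exact: oppr_measurable.
have msq : measurable_fun [set: R] (fun x : R => x ^+ 2 / 2)%R by measurability_tac.
transitivity (\int[mu]_x k (x ^+ 2 / 2)%R).
  rewrite (@ge0_integral_density _ (measurableTypeR R) R mu (normal_pdf 0 1)
    (measurable_normal_pdf 0 1) (normal_pdf_ge0 0 1) (normal_prob 0 1))//.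
  - apply: eq_integral => x _; rewrite normal_pdfE ?oner_eq0// /k /normal_fun.
    by congr (_ * (_ * expR _)%:E); rewrite subr0 expr1n mulNr.
  - by apply: (measurableT_comp (f := f) (g := fun x : R => (x ^+ 2 / 2)%R)).
pose H (s : R) := k (expR s ^+ 2 / 2)%R * (expR s)%:E.
have H0 s : 0 <= H s by rewrite mule_ge0// lee_fin expR_ge0.
have mH : measurable_fun [set: R] H.
  apply: emeasurable_funM; last by apply/measurable_EFinP; exact: measurable_expR.
  apply: (measurableT_comp (f := k) (g := fun s => expR s ^+ 2 / 2)%R) => //.
  by apply: measurable_funM => //; apply: measurable_funX; exact: measurable_expR.
rewrite integral_even; last 3 first.
- by apply: (measurableT_comp (f := k) (g := fun x : R => (x ^+ 2 / 2)%R)).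
- by move=> x.
- by move=> x; rewrite sqrrN.
rewrite -muleA; congr (_ * _).
transitivity (\int[mu]_s H s).
  rewrite (integral_ln mH H0); apply: eq_integral => x _.
  rewrite /pos_inv /H; case: ltP => x0; last by rewrite !mule0.
  by rewrite lnK ?posrE//= -[RHS]muleA -EFinM mulfV ?gt_eqF.
have half0 : (0 < 2^-1 :> R)%R by rewrite invr_gt0.
(* The substitution s = (r + ln 2) / 2 is chosen to make exp(s)^2 / 2 equal to exp(r). *)
rewrite (integral_affine_rev (ln 2 / 2)%R half0 mH H0).
pose K : R := (2^-1 * expR (ln 2 / 2))%R.
transitivity (\int[mu]_r (K%:E * (k (expR r) * (expR (2^-1 * r))%:E))).
  apply: eq_integral => r _; rewrite /H.
  have -> : (expR (2^-1 * r + ln 2 / 2) ^+ 2 / 2 = expR r)%R.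
    rewrite -expRM_natl (_ : 2%:R * _ = r + ln 2)%R; last by field.
    by rewrite expRD lnK ?posrE// mulfK.
  rewrite expRD (mulrC (expR _)) EFinM [X in _ = X]muleA (muleC K%:E) -muleA muleA.
  by rewrite (muleC (2^-1)%:E) -!muleA; congr (_ * _); rewrite -!EFinM; congr EFin; rewrite /K; ring.
have mH2 : measurable_fun [set: R] (fun r : R => k (expR r) * (expR (2^-1 * r))%:E).
  apply: emeasurable_funM; first by apply: (measurableT_comp (f := k) (g := @expR R)).
  apply/measurable_EFinP; apply: measurableT_comp => //; exact: mulrl_measurable.
have H20 r : 0 <= k (expR r) * (expR (2^-1 * r))%:E by rewrite mule_ge0// lee_fin expR_ge0.
rewrite ge0_integralZl// ?lee_fin ?mulr_ge0 ?expR_ge0//.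
rewrite (EFinM K C) -muleA; congr (_ * _).
rewrite (integral_ln mH2 H20); apply/esym; rewrite -ge0_integralZl//; last 2 first.
- by apply: emeasurable_funM => //; apply/measurable_EFinP; exact: measurable_gamma_dens.
- by move=> x _; rewrite mule_ge0// lee_fin gamma_dens_ge0.
apply/esym/eq_integral => u _; rewrite /pos_inv /gamma_dens; case: ltP => u0; last by rewrite !mule0.
rewrite lnK ?posrE// /k muleCA -!muleA; congr (_ * _); rewrite -!EFinM; congr EFin.
have -> : (u `^ (2^-1 - 1) = expR (2^-1 * ln u) * u^-1)%R.
  rewrite powRD; last by rewrite (gt_eqF u0) implybT.
  by rewrite -(powR_inv1 (ltW u0)) {1}/powR (gt_eqF u0).
by ring.
Qed.

End gamma_beta.

Section gamma_beta_algebra.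
Context (R : realType).
Local Notation mu := (@lebesgue_measure R).

Lemma measurable_inv_comp d (T : measurableType d) (f : T -> R) :
  measurable_fun setT f -> measurable_fun setT (fun t => (f t)^-1).
Proof.
move=> mf; apply: (measurableT_comp (f := fun y : R => y^-1) (g := f)) => //.
exact: measurable_inv.
Qed.

Lemma measurable_gamma_comp d (T : measurableType d) (f : T -> R) a :
  measurable_fun setT f -> measurable_fun setT (fun t => gamma_dens a (f t)).
Proof.
move=> mf; apply: (measurableT_comp (f := gamma_dens a) (g := f)) => //.
exact: measurable_gamma_dens.
Qed.

Lemma measurable_beta_comp d (T : measurableType d) (f : T -> R) a b :
  measurable_fun setT f -> measurable_fun setT (fun t => beta_dens01 a b (f t)).
Proof.
move=> mf; apply: (measurableT_comp (f := beta_dens01 a b) (g := f)) => //.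
exact: measurable_beta_dens01.
Qed.

(** The isolated factor [s] is the Jacobian of a scaling by [s]; it makes the exponents of the two
    densities add up. *)
Lemma powR_mul3 (s a b : R) : 0 < s -> s * (s `^ (a - 1) * s `^ (b - 1)) = s `^ (a + b - 1).
Proof.
move=> s0; have sn0 : s != 0 by rewrite gt_eqF.
rewrite -{1}(powRr1 (ltW s0)) -!powRD ?sn0 ?implybT//.
by congr powR; ring.
Qed.

Local Open Scope ereal_scope.

(* Substitute v = s - u, then u = r s. *)
Lemma gamma_beta (a b : R) (F : R -> R -> \bar R) :
  measurable_fun [set: R * R] (fun z => F z.1 z.2) -> (forall x y, 0 <= F x y) ->
  \int[mu]_u \int[mu]_v (F (u / (u + v))%R (u + v)%R *
    (gamma_dens a u * gamma_dens b v)%:E) =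
  \int[mu]_r \int[mu]_s (F r s * (beta_dens01 a b r * gamma_dens (a + b) s)%:E).
Proof.
move=> mF F0.
pose G (u s : R) := F (u / s)%R s * (gamma_dens a u * gamma_dens b (s - u))%:E.
have G0 u s : 0 <= G u s by rewrite mule_ge0// lee_fin mulr_ge0// gamma_dens_ge0.
have mG d (T : measurableType d) (f g : T -> R) : measurable_fun setT f ->
    measurable_fun setT g -> measurable_fun setT (fun t => G (f t) (g t)).
  move=> mf mg; apply: emeasurable_funM.
    apply: (measurable_fun2_comp mF) => //.
    by apply: measurable_funM => //; exact: measurable_inv_comp.
  apply/measurable_EFinP/measurable_funM; apply: measurable_gamma_comp => //.
  exact: measurable_funB.
transitivity (\int[mu]_u \int[mu]_s G u s).
  apply: eq_integral => u _.
  have mGu : measurable_fun [set: R] (G u) by apply: mG.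
  etransitivity; last exact: (integral_shift u mGu (G0 u)).
  by apply: eq_integral => v _; rewrite /G addrK (addrC v u).
have mG2 : measurable_fun [set: R * R] (fun z => G z.1 z.2) by apply: mG; measurability_tac.
etransitivity; first exact: (tonelli_lebesgue mG2 G0).
pose K (r s : R) := F r s * (beta_dens01 a b r * gamma_dens (a + b) s)%:E.
have K0 r s : 0 <= K r s.
  by rewrite mule_ge0// lee_fin mulr_ge0// ?gamma_dens_ge0// beta_dens01_ge0.
have mK : measurable_fun [set: R * R] (fun z : R * R => K z.1 z.2).
  apply: emeasurable_funM => //; apply/measurable_EFinP/measurable_funM.
    by apply: measurable_beta_comp; measurability_tac.
  by apply: measurable_gamma_comp; measurability_tac.
etransitivity; last exact/esym/(tonelli_lebesgue mK K0).
apply: eq_integral => s _.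
(* For s <= 0 both sides vanish, since u and s - u cannot both be positive. *)
have [s0|s0] := ltP 0%R s; last first.
  rewrite !integral0_eq// => u _.
    by rewrite /K /gamma_dens (ltNge 0%R s) s0 /= mulr0 mule0.
  rewrite /G /gamma_dens; case: ltP => u0; last by rewrite mul0r mule0.
  by rewrite subr_gt0 ltNge (le_trans s0 (ltW u0)) /= mulr0 mule0.
have mGs : measurable_fun [set: R] (G ^~ s) by apply: mG.
etransitivity; first exact: (integral_affine_rev 0 s0 mGs (G0 ^~ s)).
apply: eq_integral => r _; rewrite /G /K addr0.
have -> : (s * r / s = r)%R by rewrite mulrAC mulfV ?mul1r// gt_eqF.
rewrite muleCA; congr (_ * _); rewrite -EFinM; congr EFin.
have -> : (s - s * r = s * (1 - r))%R by ring.
rewrite /gamma_dens /beta_dens01 s0 !(pmulr_rgt0 _ s0) subr_gt0.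
case: ltP => r0; last by rewrite !(mul0r, mulr0).
case: ltP => r1; last by rewrite !(mul0r, mulr0).
rewrite -powR_mul3// !powRM ?(ltW s0) ?(ltW r0) ?subr_ge0 ?(ltW r1)//.
rewrite /beta_dens /=.
have -> : (expR (- s) = expR (- (s * r)) * expR (- (s * (1 - r))))%R.
  by rewrite -expRD; congr expR; ring.
by ring.
Qed.

(* Substitute y = x r, then x = y + (1 - y) s. *)
Lemma beta_product (a b c : R) (f : R -> \bar R) :
  measurable_fun setT f -> (forall u, 0 <= f u) ->
  \int[mu]_x \int[mu]_r (f (x * r)%R *
    (beta_dens01 (a + b) c x * beta_dens01 a b r)%:E) =
  (\int[mu]_s (beta_dens01 b c s)%:E) *
  \int[mu]_y (f y * (beta_dens01 a (b + c) y)%:E).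
Proof.
move=> mf f0.
(* The joint density of x and y = x r. All powers of x cancel, which is where the parameter [a + b]
   of the first factor is used. *)
pose k (x y : R) : R := if [&& 0 < y, y < x & x < 1]%R then
  (y `^ (a - 1) * (x - y) `^ (b - 1) * (1 - x) `^ (c - 1))%R else 0%R.
have k0 x y : (0 <= k x y)%R.
  by rewrite /k; case: ifP => // _; rewrite !mulr_ge0 ?powR_ge0.
have mk d (T : measurableType d) (g h : T -> R) : measurable_fun setT g ->
    measurable_fun setT h -> measurable_fun setT (fun t => k (g t) (h t)).
  move=> mg mh; apply: measurable_fun_ifT => //.
    apply: measurable_and; first exact: measurable_fun_ltr.
    by apply: measurable_and; exact: measurable_fun_ltr.
  apply: measurable_funM; last by apply: measurable_powR_comp; exact: measurable_funB.
  by apply: measurable_funM; apply: measurable_powR_comp => //; exact: measurable_funB.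
transitivity (\int[mu]_x \int[mu]_y (f y * (k x y)%:E)).
  apply: eq_integral => x _.
  have [/andP[x0 x1]|xN] := boolP ((0 < x) && (x < 1))%R; last first.
    rewrite !integral0_eq// => y _.
      rewrite /k; case: ifP => [/and3P[y0 yx x1]|]; last by rewrite mule0.
      by move: xN; rewrite (lt_trans y0 yx) x1.
    by rewrite /beta_dens01 (negPf xN) mul0r mule0.
  have xn0 : (x != 0)%R by rewrite gt_eqF.
  have xV0 : (0 < x^-1)%R by rewrite invr_gt0.
  pose h (r : R) := f (x * r)%R * (beta_dens01 (a + b) c x * beta_dens01 a b r)%:E.
  have h0 r : 0 <= h r by rewrite mule_ge0// lee_fin mulr_ge0// beta_dens01_ge0.
  have mh : measurable_fun setT h.
    apply: emeasurable_funM.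
      by apply: (measurableT_comp (f := f) (g := fun r => (x * r)%R)) => //; measurability_tac.
    apply/measurable_EFinP/measurable_funM => //.
    exact: measurable_beta_dens01.
  etransitivity; first exact: (integral_affine_rev 0 xV0 mh h0).
  apply: eq_integral => y _.
  rewrite /h addr0 mulrA mulfV// mul1r muleCA; congr (_ * _); rewrite -EFinM; congr EFin.
  have [p yE] : exists p, y = (x * p)%R by exists (x^-1 * y)%R; rewrite mulrA mulfV// mul1r.
  rewrite yE mulrA mulVf// mul1r /k /beta_dens01 x0 x1 /= pmulr_rgt0// gtr_pMr// andbT.
  case: ifP => [/andP[p0 p1]|_]; last by rewrite !mulr0.
  have -> : (x - x * p = x * (1 - p))%R by ring.
  rewrite !powRM ?(ltW x0) ?(ltW p0) ?subr_ge0 ?(ltW p1)// /beta_dens -powR_mul3//.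
  by field.
have mfk : measurable_fun [set: R * R] (fun z : R * R => f z.2 * (k z.1 z.2)%:E).
  apply: emeasurable_funM.
    by apply: (measurableT_comp (f := f) (g := @snd R R)).
  by apply/measurable_EFinP; apply: mk.
have fk0 x y : 0 <= f y * (k x y)%:E by rewrite mule_ge0// lee_fin.
etransitivity; first exact: (tonelli_lebesgue mfk fk0).
have mB : measurable_fun [set: R] (EFin \o beta_dens01 b c).
  by apply/measurable_EFinP; exact: measurable_beta_dens01.
set B := \int[mu]_s (beta_dens01 b c s)%:E.
have B0 : 0 <= B by apply: integral_ge0 => s _; rewrite lee_fin beta_dens01_ge0.
have mfB : measurable_fun [set: R] (fun y => f y * (beta_dens01 a (b + c) y)%:E).
  by apply: emeasurable_funM => //; apply/measurable_EFinP; exact: measurable_beta_dens01.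
have fB0 y : 0 <= f y * (beta_dens01 a (b + c) y)%:E.
  by rewrite mule_ge0// lee_fin beta_dens01_ge0.
rewrite -ge0_integralZl//.
apply: eq_integral => y _.
rewrite ge0_integralZl//; last 2 first.
- by apply/measurable_EFinP; apply: mk.
- by move=> x _; rewrite lee_fin.
rewrite muleCA; congr (_ * _).
have [/andP[y0 y1]|yN] := boolP ((0 < y) && (y < 1))%R; last first.
  rewrite integral0_eq => [|x _].
    by rewrite /beta_dens01 (negPf yN) mule0.
  rewrite /k; case: ifP => // /and3P[y0 yx x1].
  by move: yN; rewrite (lt_trans yx x1) y0.
have y1' : (0 < 1 - y)%R by rewrite subr_gt0.
have mky : measurable_fun [set: R] (fun x => (k x y)%:E).
  by apply/measurable_EFinP; apply: mk.
have ky0 x : 0 <= (k x y)%:E by rewrite lee_fin.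
etransitivity; first exact: (integral_affine_rev y y1' mky ky0).
transitivity (\int[mu]_s ((beta_dens01 a (b + c) y)%:E * (beta_dens01 b c s)%:E)); last first.
  rewrite [RHS]muleC; apply: ge0_integralZl.
  - exact: measurableT.
  - exact: mB.
  - by move=> s _; rewrite lee_fin beta_dens01_ge0.
  - by rewrite lee_fin beta_dens01_ge0.
apply: eq_integral => s _; rewrite -!EFinM; congr EFin.
have E1 : ((1 - y) * s + y - y = (1 - y) * s)%R by ring.
have E2 : (1 - ((1 - y) * s + y) = (1 - y) * (1 - s))%R by ring.
rewrite /k /beta_dens01 y0 y1 /= -(subr_gt0 y) E1 -(subr_gt0 _ 1%R) E2 !(pmulr_rgt0 _ y1') subr_gt0.
case: ifP => [/andP[s0 s1]|_]; last by rewrite !mulr0.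
rewrite !powRM ?(ltW y1') ?(ltW s0) ?subr_ge0 ?(ltW s1)// /beta_dens -powR_mul3//.
by ring.
Qed.

End gamma_beta_algebra.

(** * Gaussian families *)

Section measurable_SS.
Context (R : realType) (n : nat) d (T : measurableType d).

Definition measurable_row (v : T -> 'rV[R]_n) :=
  forall i, measurable_fun [set: T] (fun t => v t 0 i).

Lemma measurable_dot (u v : T -> 'rV[R]_n) : measurable_row u -> measurable_row v ->
  measurable_fun [set: T] (fun t => dot (u t) (v t)).
Proof. by move=> mu mv; apply: measurable_sum => i; exact: measurable_funM. Qed.

Lemma measurable_resid (I : Type) (x : I -> T -> 'rV[R]_n) (s : seq I) :
  (forall i, measurable_row (x i)) -> forall y, measurable_row y ->
  measurable_row (fun t => resid [seq x i t | i <- s] (y t)).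
Proof.
move=> mx; elim: s => [//|i s IHs] y my j /=.
under eq_fun do rewrite !mxE.
apply: measurable_funB; first exact: IHs.
apply: measurable_funM; last exact: IHs.
apply: measurable_funM; first by apply: measurable_dot; exact: IHs.
by apply: measurable_inv_comp; apply: measurable_dot; exact: IHs.
Qed.

(** Replaces the projection, defined by choice, by the Gram-Schmidt residual. Measurability of [SS]
    follows even where the vectors are dependent. *)
Lemma SS_resid (I : finType) (M : {set I}) (x : I -> 'rV[R]_n) y :
  SS M x y = sqnorm (resid [seq x i | i <- enum M] y).
Proof.
rewrite -dist2_resid /SS -/(dist2 (span_of M x) y); congr (dist2 _ y).
by rewrite big_map big_enum.
Qed.

Lemma measurable_SS (I : finType) (M : {set I}) (x : T -> I -> 'rV[R]_n) y :
  (forall i, measurable_row (x ^~ i)) -> measurable_fun [set: T] (fun t => SS M (x t) y).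
Proof.
move=> mx; under eq_fun do rewrite SS_resid sqnormE.
have mr := measurable_resid (x := fun i t => x t i) (enum M) mx (y := fun=> y).
by apply: measurable_dot; apply: mr => i; exact: measurable_cst.
Qed.

End measurable_SS.

(** * Rotation invariance of the planar Gaussian measure *)

Section normal2.
Context (R : realType).
Local Notation mu := (@lebesgue_measure R).
Local Notation gauss := (normal_prob (0 : R) 1).
Local Open Scope ereal_scope.

Lemma integral_normal_prob (f : R -> \bar R) : measurable_fun setT f ->
  (forall x, 0 <= f x) -> \int[gauss]_x f x = \int[mu]_x (f x * (normal_pdf 0 1 x)%:E).
Proof.
move=> mf f0.
exact: (@ge0_integral_density _ (measurableTypeR R) R mu (normal_pdf 0 1)
  (measurable_normal_pdf 0 1) (normal_pdf_ge0 0 1) gauss).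
Qed.

Lemma normal_pdf2_rotation (c s a b : R) : (c ^+ 2 + s ^+ 2 = 1)%R ->
  (normal_pdf 0 1 (c * a + s * b) * normal_pdf 0 1 (c * b - s * a) =
   normal_pdf 0 1 a * normal_pdf 0 1 b :> R)%R.
Proof.
move=> cs1; rewrite normal_pdfE ?oner_eq0// /normal_fun.
move: (normal_peak 1) => p; rewrite !subr0 expr1n.
have pE (X Y : R) : (p * X * (p * Y) = p * p * (X * Y))%R by ring.
rewrite [LHS]pE [RHS]pE; congr (_ * _)%R; rewrite -[LHS]expRD -[RHS]expRD; congr expR.
rewrite -[LHS]mulrDl -[RHS]mulrDl; congr (_ / _)%R.
by rewrite -[RHS]mul1r -cs1; ring.
Qed.

Lemma measurable_integral_normal d (T : measurableType d) (F : T -> R -> \bar R) :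
  measurable_fun [set: T * R] (fun z => F z.1 z.2) -> (forall x y, 0 <= F x y) ->
  measurable_fun setT (fun x => \int[gauss]_y F x y).
Proof.
move=> mF F0.
exact: (measurable_fun_fubini_tonelli_F (m2 := gauss) (fun z : T * measurableTypeR R => F z.1 z.2)).
Qed.

Lemma integral_normal2 (F : R -> R -> \bar R) :
  measurable_fun [set: R * R] (fun z => F z.1 z.2) -> (forall x y, 0 <= F x y) ->
  \int[gauss]_a \int[gauss]_b F a b =
  \int[mu]_a \int[mu]_b (F a b * (normal_pdf 0 1 a * normal_pdf 0 1 b)%:E).
Proof.
move=> mF F0.
have mFa a : measurable_fun [set: R] (F a) by apply: (measurable_fun2_comp mF).
have mI : measurable_fun [set: R] (fun a => \int[gauss]_b F a b).
  exact: measurable_integral_normal.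
have I0 a : 0 <= \int[gauss]_b F a b by exact: integral_ge0.
etransitivity; first exact: (integral_normal_prob mI I0).
apply: eq_integral => a _; rewrite muleC.
rewrite integral_normal_prob//.
have mFp : measurable_fun [set: R] (fun b => F a b * (normal_pdf 0 1 b)%:E).
  by apply: emeasurable_funM => //; apply/measurable_EFinP; exact: measurable_normal_pdf.
rewrite -ge0_integralZl//.
- by apply: eq_integral => b _; rewrite muleCA EFinM.
- by move=> b _; rewrite mule_ge0// lee_fin normal_pdf_ge0.
- by rewrite lee_fin normal_pdf_ge0.
Qed.

(** The product density depends on a^2 + b^2 only, and Lebesgue measure on the plane is invariant
    under rotations. *)
Lemma normal_rotation (c s : R) (F : R -> R -> \bar R) : (c ^+ 2 + s ^+ 2 = 1)%R ->
  measurable_fun [set: R * R] (fun z => F z.1 z.2) -> (forall x y, 0 <= F x y) ->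
  \int[gauss]_a \int[gauss]_b F (c * a + s * b)%R (c * b - s * a)%R =
  \int[gauss]_a \int[gauss]_b F a b.
Proof.
move=> cs1 mF F0.
have mF' : measurable_fun [set: R * R]
    (fun z : R * R => F (c * z.1 + s * z.2)%R (c * z.2 - s * z.1)%R).
  by apply: (measurable_fun2_comp mF); measurability_tac.
etransitivity; first exact: (integral_normal2 mF' (fun a b => F0 _ _)).
apply/esym; etransitivity; first exact: (integral_normal2 mF F0).
pose G a b := F a b * (normal_pdf 0 1 a * normal_pdf 0 1 b)%:E.
have G0 a b : 0 <= G a b by rewrite mule_ge0// lee_fin mulr_ge0// normal_pdf_ge0.
have mp f : measurable_fun [set: R * R] f ->
    measurable_fun [set: R * R] (fun z : R * R => normal_pdf 0 1 (f z) : R).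
  move=> mf; apply: (measurableT_comp (f := normal_pdf 0 1) (g := f)) => //.
  exact: measurable_normal_pdf.
have mG : measurable_fun [set: R * R] (fun z : R * R => G z.1 z.2).
  apply: emeasurable_funM => //; apply/measurable_EFinP/measurable_funM;
  by apply: mp; measurability_tac.
etransitivity; first exact/esym/(integral_rotation cs1 mG G0).
by apply: eq_integral => a _; apply: eq_integral => b _; rewrite /G normal_pdf2_rotation.
Qed.

End normal2.

(** * Sums of squares of independent Gaussian coordinates *)

Section gaussian_family.
Context (R : realType) (K : finType) d (T : measurableType d).
Variables (P : probability T R) (X : K -> T -> R).
Local Notation mu := (@lebesgue_measure R).
Local Notation gauss := (normal_prob (0 : R) 1).

Definition gaussian_family :=
  [/\ forall k, measurable_fun [set: T] (X k),
      forall k A, measurable A -> P (X k @^-1` A) = gauss A &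
      mutually_independent P [set: K] X].

Hypothesis gX : gaussian_family.

Definition upd (k : K) (a : R) (h : K -> R) : K -> R :=
  fun j => if j == k then a else h j.

Lemma measurable_upd d' (T' : measurableType d') k (f : T' -> R)
    (g : T' -> product_space R K) :
  measurable_fun setT f -> measurable_fun setT g ->
  measurable_fun setT (fun t => upd k (f t) (g t) : product_space R K).
Proof.
move=> mf mg; apply: measurable_to_product_space => j; rewrite /upd.
case: (j == k) => //.
by apply: (measurableT_comp (f := fun h : product_space R K => h j) (g := g)) => //;
  exact: measurable_coord.
Qed.

Local Open Scope ereal_scope.

Lemma integral_coord k (f : R -> \bar R) : measurable_fun setT f ->
  (forall x, 0 <= f x) -> \int[P]_t f (X k t) = \int[gauss]_x f x.
Proof.
move=> mf f0; case: gX => mX lX _.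
have mXk : measurable_fun setT (X k : T -> measurableTypeR R) := mX k.
pose m := measure_function_pushforward__canonical__measure_function_Measure P mXk.
transitivity (\int[m]_x f x); last by apply: eq_measure_integral => A mA _; exact: lX.
by rewrite ge0_integral_pushforward// preimage_setT.
Qed.

(** Decoupling with the single coordinate [k] redrawn; its law being known, the inner integral
    becomes a Gaussian one. *)
Lemma integral_one_coord k (Psi : product_space R K -> \bar R) :
  measurable_fun setT Psi -> (forall h, 0 <= Psi h) ->
  \int[P]_t Psi (X^~ t) = \int[P]_t \int[gauss]_a Psi (upd k a (X^~ t)).
Proof.
move=> mPsi Psi0; case: (gX) => mX _ iX.
etransitivity; first exact: (decoupling mX iX (pred1 k) mPsi Psi0).
apply: eq_integral => t _.
have mu1 : measurable_fun [set: R] (fun a => Psi (upd k a (X^~ t))).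
  apply: (measurableT_comp (f := Psi)) => //.
  by apply: (measurable_upd k (f := fun a : R => a) (g := fun=> X^~ t)).
etransitivity; last exact: (integral_coord k mu1).
apply: eq_integral => t' _; congr Psi; apply/funext => j.
by rewrite /upd /=; case: eqP => [->|].
Qed.

Lemma probability_coord0 k : P (X k @^-1` [set 0%R]) = 0.
Proof. by case: gX => _ lX _; rewrite lX// /normal_prob integral_set1. Qed.

(** Halved so that the gamma density has scale one. *)
Definition half_sumsq (J : {set K}) (h : product_space R K) : R := (\sum_(j in J) h j ^+ 2 / 2)%R.

Lemma measurable_half_sumsq J : measurable_fun [set: product_space R K] (half_sumsq J).
Proof.
rewrite /half_sumsq; under eq_fun do rewrite big_mkcond /=.
apply: measurable_sum => j; case: (j \in J) => //.
by apply: measurable_funM => //; apply: measurable_funX; exact: measurable_coord.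
Qed.

Lemma half_sumsq_upd (J : {set K}) k a h : k \notin J -> half_sumsq J (upd k a h) = half_sumsq J h.
Proof.
move=> kJ; apply: eq_bigr => j jJ; rewrite /upd.
by case: eqP jJ kJ => [->->|].
Qed.

Lemma half_sumsqU1 (J : {set K}) k a h : k \notin J ->
  half_sumsq (k |: J) (upd k a h) = (a ^+ 2 / 2 + half_sumsq J h)%R.
Proof.
move=> kJ; rewrite /half_sumsq big_setU1//= {1}/upd eqxx; congr (_ + _)%R.
exact: half_sumsq_upd.
Qed.

(** Coordinates are peeled off one by one, each adding 1/2 to the gamma parameter. [J] is nonempty
    because an empty sum has no density. *)
Lemma half_sumsq_law q (J : {set K}) : #|J| = q.+1 ->
  exists2 c : \bar R, 0 <= c &
  forall f : R -> \bar R, measurable_fun setT f -> (forall u, 0 <= f u) ->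
  \int[P]_t f (half_sumsq J (X^~ t)) =
  c * \int[mu]_u (f u * (gamma_dens (q.+1%:R / 2) u)%:E).
Proof.
have [c1 c10 sqlaw] := normal_square_law R.
have step (k : K) (J' : {set K}) (f : R -> \bar R) : k \notin J' ->
    measurable_fun setT f -> (forall u, 0 <= f u) ->
    \int[P]_t f (half_sumsq (k |: J') (X^~ t)) =
    c1 * \int[P]_t \int[mu]_v (f (v + half_sumsq J' (X^~ t))%R * (gamma_dens 2^-1 v)%:E).
  move=> kJ' mf f0.
  have mPsi : measurable_fun [set: product_space R K] (fun h => f (half_sumsq (k |: J') h)).
    apply: (measurableT_comp (f := f) (g := half_sumsq (k |: J'))) => //.
    exact: measurable_half_sumsq.
  etransitivity; first exact: (integral_one_coord k mPsi (fun h => f0 _)).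
  case: (gX) => mX _ _.
  have mW : measurable_fun [set: T] (fun t => half_sumsq J' (X^~ t)).
    apply: (measurableT_comp (f := half_sumsq J') (g := fun t => X^~ t : product_space R K)).
      exact: measurable_half_sumsq.
    exact: measurable_to_product_space.
  rewrite -ge0_integralZl//; last 2 first.
  - apply: (measurable_integral2 (F := fun t v =>
      f (v + half_sumsq J' (X^~ t))%R * (gamma_dens 2^-1 v)%:E)).
      apply: emeasurable_funM.
        apply: (measurableT_comp (f := f) (g := fun z : T * R => z.2 + half_sumsq J' (X^~ z.1))%R) => //.
        apply: measurable_funD => //.
        by apply: (measurableT_comp (f := fun t => half_sumsq J' (X^~ t)) (g := @fst T R)).
      by apply/measurable_EFinP; apply: measurable_gamma_comp.
    by move=> t v; rewrite mule_ge0// lee_fin gamma_dens_ge0.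
  - by move=> t _; apply: integral_ge0 => v _; rewrite mule_ge0// lee_fin gamma_dens_ge0.
  apply: eq_integral => t _.
  under eq_integral do rewrite half_sumsqU1//.
  apply: (sqlaw (fun u => f (u + half_sumsq J' (X^~ t))%R)) => //.
  apply: (measurableT_comp (f := f) (g := fun u : R => (u + half_sumsq J' (X^~ t))%R)) => //.
  exact: measurable_funD.
elim: q J => [|q IHq] J.
  move=> /eqP/cards1P[k ->]; exists c1; first exact: c10.
  move=> f mf f0; rewrite -[[set k]%SET]finset.setU0 step ?inE//; congr (_ * _).
  transitivity (\int[P]_t cst (\int[mu]_v (f v * (gamma_dens 2^-1 v)%:E)) t).
    apply: eq_integral => t _; apply: eq_integral => v _.
    by rewrite /half_sumsq big_set0 addr0.
  by rewrite integral_cst// [X in _ * X]probability_setT mule1 div1r.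
move=> Jq; have /card_gt0P[k kJ] : (0 < #|J|)%N by rewrite Jq.
have [|c c0 IH] := IHq (J :\ k)%SET.
  by have := cardsD1 k J; rewrite Jq kJ => -[->].
(* The test function sees only the sum of the two gamma variables, so the beta factor of
   [gamma_beta] integrates to this constant. *)
pose B := \int[mu]_r (beta_dens01 (q.+1%:R / 2) 2^-1 r)%:E.
have B0 : 0 <= B by apply: integral_ge0 => s _; rewrite lee_fin beta_dens01_ge0.
exists (c1 * (c * B)); first by rewrite !mule_ge0.
move=> f mf f0; rewrite -(finset.setD1K kJ) step//; last by rewrite !inE eqxx.
rewrite -!muleA; congr (_ * _).
pose g w := \int[mu]_v (f (v + w)%R * (gamma_dens 2^-1 v)%:E).
have mfg : measurable_fun [set: R * R]
    (fun z : R * R => f (z.2 + z.1)%R * (gamma_dens 2^-1 z.2)%:E).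
  apply: emeasurable_funM.
    apply: (measurableT_comp (f := f) (g := fun z : R * R => z.2 + z.1)%R) => //.
    by measurability_tac.
  by apply/measurable_EFinP; apply: measurable_gamma_comp.
have fg0 (w v : R) : 0 <= f (v + w)%R * (gamma_dens 2^-1 v)%:E.
  by rewrite mule_ge0// lee_fin gamma_dens_ge0.
have mg : measurable_fun [set: R] g by exact: (measurable_integral2 mfg fg0).
have g0 w : 0 <= g w by apply: integral_ge0 => v _; exact: fg0.
etransitivity; first exact: (IH g mg g0).
congr (_ * _).
have mF : measurable_fun [set: R * R] (fun z : R * R => f z.2).
  by apply: (measurableT_comp (f := f) (g := @snd R R)).
have mfu (u : R) : measurable_fun [set: R] (fun v => f (v + u)%R * (gamma_dens 2^-1 v)%:E).
  apply: emeasurable_funM; last by apply/measurable_EFinP; exact: measurable_gamma_dens.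
  apply: (measurableT_comp (f := f) (g := fun v : R => (v + u)%R)) => //.
  exact: measurable_funD.
have GB := gamma_beta (q.+1%:R / 2) 2^-1 mF (fun _ s => f0 s).
transitivity (\int[mu]_u \int[mu]_v (f (u + v)%R *
    (gamma_dens (q.+1%:R / 2) u * gamma_dens 2^-1 v)%:E)).
  apply: eq_integral => u _.
  transitivity (\int[mu]_v ((gamma_dens (q.+1%:R / 2) u)%:E *
      (f (v + u)%R * (gamma_dens 2^-1 v)%:E))); last first.
    by apply: eq_integral => v _; rewrite muleCA EFinM addrC.
  rewrite muleC; apply/esym; apply: ge0_integralZl.
  - exact: measurableT.
  - exact: mfu.
  - by move=> v _; exact: fg0.
  - by rewrite lee_fin gamma_dens_ge0.
etransitivity; first exact: GB.
have E : (q.+1%:R / 2 + 2^-1 = q.+2%:R / 2 :> R)%R by rewrite -[q.+2]addn1 natrD mulrDl div1r.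
rewrite E; set Gm := \int[mu]_u (f u * (gamma_dens (q.+2%:R / 2) u)%:E).
have gd0 (a u : R) : 0 <= (gamma_dens a u)%:E by rewrite lee_fin gamma_dens_ge0.
have Gm0 : 0 <= Gm by apply: integral_ge0 => v _; exact: (mule_ge0 (f0 _) (gd0 _ _)).
transitivity (\int[mu]_r ((beta_dens01 (q.+1%:R / 2) 2^-1 r)%:E * Gm)).
  apply: eq_integral => r _.
  transitivity (\int[mu]_s ((beta_dens01 (q.+1%:R / 2) 2^-1 r)%:E *
      (f s * (gamma_dens (q.+2%:R / 2) s)%:E))).
    by apply: eq_integral => s _; rewrite muleCA EFinM.
  apply: ge0_integralZl.
  - exact: measurableT.
  - by apply: emeasurable_funM; [exact: mf|apply/measurable_EFinP; exact: measurable_gamma_dens].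
  - by move=> s _; exact: (mule_ge0 (f0 _) (gd0 _ _)).
  - by rewrite lee_fin beta_dens01_ge0.
apply: ge0_integralZr.
- exact: measurableT.
- by apply/measurable_EFinP; exact: measurable_beta_dens01.
- by move=> r _; rewrite lee_fin beta_dens01_ge0.
- exact: Gm0.
Qed.

End gaussian_family.

(** * Beta laws *)

Section beta_law.
Context (R : realType) d (T : measurableType d) (P : probability T R).
Local Notation mu := (@lebesgue_measure R).
Local Open Scope ereal_scope.

Definition beta_mass (a b : R) : \bar R := \int[mu]_u (beta_dens01 a b u)%:E.

(** [fine] mirrors the normalisation in [beta_meas], so the two agree without a prior proof that the
    mass is finite. *)
Definition has_beta_law (a b : R) (U : T -> R) :=
  forall f : R -> \bar R, measurable_fun setT f -> (forall u, 0 <= f u) ->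
  \int[P]_t f (U t) =
  ((fine (beta_mass a b))^-1)%:E * \int[mu]_u (f u * (beta_dens01 a b u)%:E).

Lemma beta_mass_ge0 a b : 0 <= beta_mass a b.
Proof. by apply: integral_ge0 => u _; rewrite lee_fin beta_dens01_ge0. Qed.

(* Taking [f = 1] forces the constant to be the inverse of the total mass. *)
Lemma has_beta_lawP a b (U : T -> R) (c : \bar R) : 0 <= c ->
  (forall f : R -> \bar R, measurable_fun setT f -> (forall u, 0 <= f u) ->
    \int[P]_t f (U t) = c * \int[mu]_u (f u * (beta_dens01 a b u)%:E)) ->
  has_beta_law a b U.
Proof.
move=> c0 Uc f mf f0; rewrite Uc//; congr (_ * _).
have : 1 = c * beta_mass a b.
  have := Uc (cst 1) (measurable_cst _) (fun=> lee01).
  rewrite integral_cst// [X in _ * X]probability_setT mule1 => ->; congr (_ * _).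
  by apply: eq_integral => u _; rewrite mul1e.
(* With an infinite factor, the product of two elements of [0, +oo] is 0 or +oo and cannot be 1. *)
move: c0 (beta_mass_ge0 a b); case: c {Uc} => [r r0|_|//].
  case: (beta_mass a b) => [m m0|_|//]; last first.
    move: r0; rewrite lee_fin le_eqVlt => /predU1P[<-|r0].
      by rewrite mul0e => /eqP; rewrite onee_eq0.
    by rewrite gt0_muley ?lte_fin.
  rewrite -EFinM => -[rm]; congr EFin => /=.
  have m0' : (m != 0)%R by apply/eqP => m0'; move/eqP: rm; rewrite m0' mulr0 oner_eq0.
  by rewrite -[RHS]mul1r rm mulfK.
case: (beta_mass a b) => [m m0|_|//]; last by rewrite mulyy.
move: m0; rewrite lee_fin le_eqVlt => /predU1P[<-|m0].
  by rewrite mule0 => /eqP; rewrite onee_eq0.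
by rewrite gt0_mulye ?lte_fin.
Qed.

Lemma integral_beta_meas a b (A : set R) : measurable A ->
  \int[mu]_(u in A `&` `]0%R, 1%R[) (beta_dens a b u)%:E =
  \int[mu]_u ((\1_A u)%:E * (beta_dens01 a b u)%:E).
Proof.
move=> mA; rewrite integral_mkcond; apply: eq_integral => u _.
rewrite patchE /beta_dens01 indicE in_setI.
have -> : (u \in `]0%R, 1%R[%classic) = (0 < u)%R && (u < 1)%R.
  by apply/idP/idP; rewrite inE /= in_itv.
by case: (u \in A) => /=; rewrite ?mul1e ?mul0e//; case: ifP.
Qed.

Lemma has_beta_law_prob a b (U : T -> R) : measurable_fun setT U ->
  has_beta_law a b U -> forall A, measurable A -> P (U @^-1` A) = beta_meas a b A.
Proof.
move=> mU lU A mA; rewrite /beta_meas integral_beta_meas//.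
have -> : \int[mu]_(u in `]0%R, 1%R[) (beta_dens a b u)%:E = beta_mass a b.
  rewrite -[`]0%R, 1%R[%classic]setTI integral_beta_meas//.
  by apply: eq_integral => u _; rewrite indicT mul1e.
have mUA : measurable (U @^-1` A) by rewrite -[X in measurable X]setTI; exact: mU.
have m1A : measurable_fun [set: R] (fun u => (\1_A u)%:E : \bar R).
  by apply/measurable_EFinP; exact: measurable_indic.
have := lU _ m1A; rewrite muleC => <-; last by move=> u; rewrite lee_fin.
by rewrite -[U @^-1` A]setIT -integral_indic.
Qed.

End beta_law.

(** * Law of the ratio of sums of squares *)

Section ratio_law.
Context (R : realType) (K : finType) d (T : measurableType d).
Variables (P : probability T R) (X : K -> T -> R).
Hypothesis gX : gaussian_family P X.
Local Notation mu := (@lebesgue_measure R).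
Local Open Scope ereal_scope.

(** With u the half sum over [J] and v the half square at [k], the variable is u / (u + v); in
    [gamma_beta] the test function now ignores the sum, whose gamma factor integrates to the
    constant [G]. *)
Lemma ratio_law q (J : {set K}) k : k \notin J -> #|J| = q.+1 ->
  has_beta_law P (q.+1%:R / 2) 2^-1
    (fun t => 1 - X k t ^+ 2 / (X k t ^+ 2 + \sum_(j in J) X j t ^+ 2))%R.
Proof.
move=> kJ Jq; have [c1 c10 sqlaw] := normal_square_law R.
have [c c0 Jlaw] := half_sumsq_law gX Jq.
pose G := \int[mu]_s (gamma_dens (q.+1%:R / 2 + 2^-1) s)%:E.
have gd0 (a u : R) : 0 <= (gamma_dens a u)%:E by rewrite lee_fin gamma_dens_ge0.
have G0 : 0 <= G by apply: integral_ge0.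
apply: (@has_beta_lawP _ _ _ _ _ _ _ (c1 * (c * G))).
  exact: (mule_ge0 c10 (mule_ge0 c0 G0)).
move=> f mf f0.
(* Agrees with u / (u + v) for positive arguments; at (0, 0) it is 1 instead of 0, but the gamma
   densities vanish there. *)
pose rho (u v : R) : R := (1 - 2 * v / (2 * v + 2 * u))%R.
have rhoE (u v : R) : (0 < u)%R -> (0 < v)%R -> rho u v = (u / (u + v))%R.
  move=> u0 v0; have uv0 : (u + v != 0)%R by rewrite gt_eqF// addr_gt0.
  by rewrite /rho -mulrDr -mulf_div divff// mul1r (addrC v u) -{1}(mulfV uv0) -mulrBl addrK.
have mrho d' (T' : measurableType d') (g h : T' -> R) : measurable_fun setT g ->
    measurable_fun setT h -> measurable_fun setT (fun t => rho (g t) (h t)).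
  move=> mg mh; apply: measurable_funB; first exact: measurable_cst.
  apply: measurable_funM; first by apply: measurable_funM.
  by apply: measurable_inv_comp; apply: measurable_funD; apply: measurable_funM.
have mfrho d' (T' : measurableType d') (g h : T' -> R) : measurable_fun setT g ->
    measurable_fun setT h -> measurable_fun setT (fun t => f (rho (g t) (h t))).
  move=> mg mh; apply: (measurableT_comp (f := f) (g := fun t => rho (g t) (h t))) => //.
  exact: mrho.
pose Psi (h : product_space R K) := f (rho (half_sumsq J h) (h k ^+ 2 / 2)%R).
have mPsi : measurable_fun setT Psi.
  apply: mfrho; first exact: measurable_half_sumsq.
  by apply: measurable_funM => //; apply: measurable_funX; exact: measurable_coord.
transitivity (\int[P]_t Psi (X^~ t)).
  apply: eq_integral => t _; congr f; rewrite /rho /half_sumsq -mulr_suml.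
  by congr (1 - _ / (_ + _))%R; rewrite mulrC divfK.
etransitivity; first exact: (integral_one_coord gX k mPsi (fun h => f0 _)).
pose g w := \int[mu]_v (f (rho w v) * (gamma_dens 2^-1 v)%:E).
have fg0 (w v : R) : 0 <= f (rho w v) * (gamma_dens 2^-1 v)%:E.
  exact: (mule_ge0 (f0 _) (gd0 _ _)).
have mfg : measurable_fun [set: R * R]
    (fun z : R * R => f (rho z.1 z.2) * (gamma_dens 2^-1 z.2)%:E).
  apply: emeasurable_funM; first by apply: mfrho.
  by apply/measurable_EFinP; apply: measurable_gamma_comp.
have mg : measurable_fun [set: R] g by exact: (measurable_integral2 mfg fg0).
have g0 w : 0 <= g w by apply: integral_ge0 => v _; exact: fg0.
transitivity (\int[P]_t (c1 * g (half_sumsq J (X^~ t)))).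
  apply: eq_integral => t _.
  have mft : measurable_fun [set: R] (fun v => f (rho (half_sumsq J (X^~ t)) v)).
    by apply: mfrho.
  etransitivity; last exact: (sqlaw _ mft (fun v => f0 _)).
  by apply: eq_integral => a _; rewrite /Psi half_sumsq_upd// /upd eqxx.
have mgX : measurable_fun [set: T] (fun t => g (half_sumsq J (X^~ t))).
  apply: (measurableT_comp (f := g) (g := fun t => half_sumsq J (X^~ t))) => //.
  apply: (measurableT_comp (f := half_sumsq J) (g := fun t => X^~ t : product_space R K)).
    exact: measurable_half_sumsq.
  by apply: measurable_to_product_space; case: gX.
etransitivity.
  apply: ge0_integralZl; [exact: measurableT|exact: mgX|by move=> t _; exact: g0|exact: c10].
rewrite -!muleA; congr (_ * _).
etransitivity; first exact: (Jlaw g mg g0).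
congr (_ * _).
have mF : measurable_fun [set: R * R] (fun z : R * R => f z.1).
  by apply: (measurableT_comp (f := f) (g := @fst R R)).
have GB := gamma_beta (q.+1%:R / 2) 2^-1 mF (fun r _ => f0 r).
have mfu (u : R) : measurable_fun [set: R] (fun v => f (rho u v) * (gamma_dens 2^-1 v)%:E).
  apply: emeasurable_funM; first by apply: mfrho.
  by apply/measurable_EFinP; exact: measurable_gamma_dens.
transitivity (\int[mu]_u \int[mu]_v (f (u / (u + v))%R *
    (gamma_dens (q.+1%:R / 2) u * gamma_dens 2^-1 v)%:E)).
  apply: eq_integral => u _.
  transitivity (\int[mu]_v ((gamma_dens (q.+1%:R / 2) u)%:E *
      (f (rho u v) * (gamma_dens 2^-1 v)%:E))).
    rewrite muleC; apply/esym; apply: ge0_integralZl.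
    - exact: measurableT.
    - exact: mfu.
    - by move=> v _; exact: fg0.
    - exact: gd0.
  apply: eq_integral => v _; rewrite muleCA -EFinM /gamma_dens.
  case: (ltP 0%R u) => u0; last by rewrite !mul0r !mule0.
  case: (ltP 0%R v) => v0; last by rewrite !mulr0 !mule0.
  by congr (f _ * _); exact: rhoE.
etransitivity; first exact: GB.
set F := \int[mu]_u (f u * (beta_dens01 (q.+1%:R / 2) 2^-1 u)%:E).
transitivity (\int[mu]_r ((f r * (beta_dens01 (q.+1%:R / 2) 2^-1 r)%:E) * G)).
  apply: eq_integral => r _.
  transitivity (\int[mu]_s ((f r * (beta_dens01 (q.+1%:R / 2) 2^-1 r)%:E) *
      (gamma_dens (q.+1%:R / 2 + 2^-1) s)%:E)).
    by apply: eq_integral => s _; rewrite -muleA -EFinM.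
  apply: ge0_integralZl.
  - exact: measurableT.
  - by apply/measurable_EFinP; exact: measurable_gamma_dens.
  - by move=> s _; exact: gd0.
  - by apply: mule_ge0; [exact: f0|rewrite lee_fin beta_dens01_ge0].
rewrite muleC; apply: ge0_integralZr.
- exact: measurableT.
- by apply: emeasurable_funM; [exact: mf|apply/measurable_EFinP; exact: measurable_beta_dens01].
- by move=> r _; apply: mule_ge0; [exact: f0|rewrite lee_fin beta_dens01_ge0].
- exact: G0.
Qed.

End ratio_law.

(** * Adding one Gaussian vector *)

Section gaussian_vector.
Context (R : realType) (n : nat) d (T : measurableType d).
Variables (P : probability T R) (X : 'I_n -> T -> R).
Hypothesis gX : gaussian_family P X.
Local Notation gauss := (normal_prob (0 : R) 1).
Local Notation space := (product_space R 'I_n).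

Definition rotate (H : 'M[R]_n) (h : space) : space := fun j => (\row_i h i *m H) 0 j.

Lemma measurable_rotate H : measurable_fun [set: space] (rotate H).
Proof.
apply: measurable_to_product_space => j; rewrite /rotate.
under eq_fun do rewrite mxE.
apply: measurable_sum => i; under eq_fun do rewrite mxE.
by apply: measurable_funM => //; exact: measurable_coord.
Qed.

Lemma rotateM H1 H2 h : rotate (H1 *m H2) h = rotate H2 (rotate H1 h).
Proof.
apply/funext => j; rewrite /rotate mulmxA; congr (fun_of_matrix (_ *m _) _ _).
by apply/rowP => i; rewrite [RHS]mxE.
Qed.

Lemma rotate_givens k l c s a b h : k != l ->
  rotate (givens k l c s) (upd l b (upd k a h)) =
  upd l (c * b - s * a) (upd k (c * a + s * b) h).
Proof.
move=> kl; apply/funext => j; rewrite /rotate mul_givens// /givens_row !mxE /upd.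
rewrite !eqxx (negPf kl).
have [->|jk] := eqVneq j k; first by rewrite (negPf kl).
by case: eqP.
Qed.

Local Open Scope ereal_scope.

Lemma integral_two_coord k l (Psi : space -> \bar R) :
  measurable_fun setT Psi -> (forall h, 0 <= Psi h) ->
  \int[P]_t Psi (X^~ t) =
  \int[P]_t \int[gauss]_a \int[gauss]_b Psi (upd l b (upd k a (X^~ t))).
Proof.
move=> mPsi Psi0.
etransitivity; first exact: (integral_one_coord gX l mPsi Psi0).
pose Psi1 (h : space) := \int[gauss]_b Psi (upd l b h).
have mPsi1 : measurable_fun [set: space] Psi1.
  apply: (measurable_integral_normal (F := fun (h : space) (b : R) => Psi (upd l b h))) => //.
  apply: (measurableT_comp (f := Psi) (g := fun z : space * R => upd l z.2 z.1 : space)) => //.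
  exact: measurable_upd.
have Psi10 h : 0 <= Psi1 h by apply: integral_ge0 => b _; exact: Psi0.
exact: (integral_one_coord gX k mPsi1 Psi10).
Qed.

(** Induction on the generators. A Givens rotation acts on coordinates [k] and [l] only; these are
    redrawn, and the planar invariance applies to the two inner integrals. *)
Lemma rotation_invariance H (Psi : space -> \bar R) : rotation H ->
  measurable_fun setT Psi -> (forall h, 0 <= Psi h) ->
  \int[P]_t Psi (rotate H (X^~ t)) = \int[P]_t Psi (X^~ t).
Proof.
move=> rH; elim: rH Psi => [|k l c s kl cs1|H1 H2 _ IH1 _ IH2] Psi mPsi Psi0.
- apply: eq_integral => t _; congr Psi; apply/funext => j.
  by rewrite /rotate mulmx1 mxE.
- have mPr : measurable_fun [set: space] (fun h => Psi (rotate (givens k l c s) h)).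
    apply: (measurableT_comp (f := Psi) (g := rotate (givens k l c s))) => //.
    exact: measurable_rotate.
  etransitivity; first exact: (integral_two_coord k l mPr (fun h => Psi0 _)).
  apply/esym; etransitivity; first exact: (integral_two_coord k l mPsi Psi0).
  apply: eq_integral => t _.
  pose F a b := Psi (upd l b (upd k a (X^~ t))).
  have mF : measurable_fun [set: R * R] (fun z : R * R => F z.1 z.2).
    apply: (measurableT_comp (f := Psi)
      (g := fun z : R * R => upd l z.2 (upd k z.1 (X^~ t)) : space)) => //.
    apply: measurable_upd => //.
    by apply: (measurable_upd k (g := fun=> X^~ t)).
  etransitivity; first exact/esym/(normal_rotation cs1 mF (fun a b => Psi0 _)).
  apply: eq_integral => a _; apply: eq_integral => b _.
  by rewrite /F rotate_givens.
- have mPr : measurable_fun [set: space] (fun h => Psi (rotate H2 h)).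
    by apply: (measurableT_comp (f := Psi) (g := rotate H2)) => //; exact: measurable_rotate.
  etransitivity; last exact: (IH2 Psi mPsi Psi0).
  etransitivity; last exact: (IH1 _ mPr (fun h => Psi0 _)).
  by apply: eq_integral => t _; rewrite rotateM.
Qed.

Local Close Scope ereal_scope.

Variables (V : 'M[R]_n) (y : 'rV[R]_n) (m : nat).
Hypotheses (rV : \rank V = m) (mn : (m.+1 < n)%N) (yV : ~~ (y <= V)%MS).

Local Notation w t := (\row_i X i t).

Lemma dist2_neq0 : dist2 V y != 0.
Proof.
apply: contra yV; rewrite (dist2E (oprojP V y)) => /eqP/dot_eq0/eqP.
by rewrite subr_eq0 => /eqP->; case: (oprojP V y).
Qed.

Lemma card_ord_gt : #|[set j : 'I_n | (m < j)%N]%SET| = (n - m.+1)%N.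
Proof.
rewrite -sum1_card (eq_bigl (fun j : 'I_n => true && (m.+1 <= j)%N)); last first.
  by move=> j; rewrite inE.
by rewrite -(big_geq_mkord _ _ xpredT (fun=> 1%N)) sum_nat_const_nat muln1.
Qed.

Lemma one_step_law :
  has_beta_law P ((n - m.+1)%:R / 2) 2^-1 (fun t => dist2 (<<w t>> + V)%MS y / dist2 V y).
Proof.
have [H rH aH] := adapted_rotation_exists V y.
pose om : 'I_n := Ordinal (ltnW mn).
have rVm : \rank V = om by [].
pose J : {set 'I_n} := [set j : 'I_n | (m < j)%N]%SET.
have omJ : om \notin J by rewrite inE /= ltnn.
(* Since m + 1 < n, at least one coordinate lies beyond [m], as [ratio_law] requires. *)
have [q qE] : exists q, (n - m.+1)%N = q.+1 by exists (n - m.+1).-1; rewrite prednK// subn_gt0.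
have Jq : #|J| = q.+1 by rewrite card_ord_gt.
move=> f mf f0; rewrite qE; apply/esym; etransitivity.
  by apply/esym; apply: (ratio_law gX omJ Jq).
pose Psi (h : space) := f (1 - h om ^+ 2 / (h om ^+ 2 + \sum_(j in J) h j ^+ 2)).
have mPsi : measurable_fun setT Psi.
  have mo j : measurable_fun [set: space] (fun h : space => h j ^+ 2).
    by apply: measurable_funX; exact: measurable_coord.
  apply: (measurableT_comp (f := f)
    (g := fun h : space => 1 - h om ^+ 2 / (h om ^+ 2 + \sum_(j in J) h j ^+ 2))) => //.
  apply: measurable_funB; first exact: measurable_cst.
  apply: measurable_funM; first exact: mo.
  apply: measurable_inv_comp; apply: measurable_funD; first exact: mo.
  under eq_fun do rewrite big_mkcond /=.
  by apply: measurable_sum => j; case: (j \in J).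
(* [w *m H] has the law of [w], and in its coordinates the quotient of distances is the expression
   in [Psi]. *)
etransitivity; first exact/esym/(rotation_invariance rH mPsi (fun h => f0 _)).
apply: eq_integral => t _; congr f.
rewrite (dist2_adapted_add rH aH rVm) mulrBl mulfV ?dist2_neq0//; congr (1 - _).
have DE (a b c : R) : a != 0 -> a * b / c / a = b / c.
  by move=> a0; rewrite mulrAC (mulrC a b) mulfK.
rewrite DE ?dist2_neq0//.
rewrite [in RHS](bigD1 om)//=; congr (_ / (_ + _)).
by apply: eq_bigl => j; rewrite inE ltn_neqAle andbC eq_sym.
Qed.

(** Keeps [y] outside [V + w] for almost every frozen row [w]. A vector of [<<y>> + V] has rotated
    coordinates zero beyond [m], whereas coordinate m + 1 of the rotated [w] is almost surely
    nonzero. *)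
Lemma one_step_ae : {ae P, forall t, ~~ (w t <= <<y>> + V)%MS}.
Proof.
have [H rH aH] := adapted_rotation_exists V y.
(* Index m + 1, counted from 0: the first coordinate that the adapted rotation forces to vanish on
   [<<y>> + V]. *)
pose om : 'I_n := Ordinal mn.
pose Y t := rotate H (X^~ t) om.
have mX : measurable_fun [set: T] (fun t => X^~ t : space).
  by apply: measurable_to_product_space; case: gX.
have mY : measurable_fun setT Y.
  apply: (measurableT_comp (f := fun h : space => rotate H h om) (g := fun t => X^~ t : space)) => //.
  apply: (measurableT_comp (f := fun h : space => h om) (g := rotate H)).
    exact: measurable_coord.
  exact: measurable_rotate.
exists (Y @^-1` [set 0]); split.
- by rewrite -[X in measurable X]setTI; apply: mY.
- pose Psi (h : space) : \bar R := (\1_[set (0:R)] (h om))%:E.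
  have mPsi : measurable_fun setT Psi.
    apply: (measurableT_comp (f := fun r : R => (\1_[set (0:R)] r)%:E : \bar R)
      (g := fun h : space => h om)); last exact: measurable_coord.
    by apply/measurable_EFinP; apply: measurable_indic; exact: measurable_set1.
  have Psi0 h : (0 <= Psi h)%E by rewrite lee_fin.
  (* Applied to the indicator of a zero coordinate, invariance gives P (Y = 0) = P (X om = 0) =
     0. *)
  have := rotation_invariance rH mPsi Psi0.
  have indE (g : T -> R) : measurable_fun setT g ->
      (\int[P]_t (\1_[set (0:R)] (g t))%:E = P (g @^-1` [set (0%R : R)]))%E.
    move=> mg; rewrite -[g @^-1` _]setIT -integral_indic//.
    by rewrite -[X in measurable X]setTI; apply: mg.
  rewrite (indE Y mY) (indE (X om)); last by case: gX.
  by rewrite (probability_coord0 gX).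
- move=> t /=; apply: contra_notP => Yt; apply/negP => /sub_addsmxP[[u1 u2] /= wE].
  apply: Yt; rewrite /Y /rotate wE mulmxDl mxE.
  case: aH => HV _ Hy.
  rewrite [X in _ + X]HV ?submxMl// ?rV//.
  have [a ->] : exists a, u1 *m <<y>>%MS = a *: y.
    by apply/sub_rVP; rewrite (submx_trans (submxMl _ _))// genmxE.
  by rewrite -scalemxAl mxE Hy ?rV// mulr0 addr0.
Qed.

End gaussian_vector.

(** * Adding all Gaussian vectors *)

Section independence.
Context (R : realType) d (T : measurableType d) (P : probability T R).
Local Open Scope ereal_scope.

Lemma mutually_independent_sub (K : finType) (S S' : {set K}) (X : K -> T -> R) :
  (S' \subset S)%SET -> mutually_independent P S X -> mutually_independent P S' X.
Proof.
move=> S'S iX B mB.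
pose B' k := if k \in S' then B k else setT.
have mB' k : measurable (B' k) by rewrite /B'; case: ifP.
have := iX B' mB'.
have -> : \prod_(k in S) P (X k @^-1` B' k) = \prod_(k in S') P (X k @^-1` B k).
  rewrite big_mkcond [RHS]big_mkcond; apply: eq_bigr => k _; rewrite /B'.
  case: ifP => kS; case: ifP => kS' //; last by rewrite (fintype.subsetP S'S k kS') in kS.
  by rewrite preimage_setT probability_setT.
move=> <-; congr (P _); apply/seteqP; split=> t /= H k.
  by move=> _; rewrite /B'; case: ifP => // /H.
move=> kS'; have := H k; rewrite /B' kS'; apply.
exact: (fintype.subsetP S'S).
Qed.

(** Constants are independent of everything: if some [B k] with [k] outside [S] misses 0, both sides
    are 0. This gives a family on the full index type, as decoupling requires. *)
Lemma mutually_independent_zero (K : finType) (S : {set K}) (X : K -> T -> R) :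
  mutually_independent P S X ->
  mutually_independent P [set: K]%SET (fun k t => if k \in S then X k t else 0%R).
Proof.
move=> iX B mB.
rewrite [RHS](eq_bigl xpredT); last by move=> k; rewrite finset.in_setT.
have [B0|nB0] := pselect (forall k, k \notin S -> B k 0%R).
  transitivity (P [set t | forall k, k \in S -> B k (X k t)]).
    congr (P _); apply/seteqP; split=> t /= H k.
      by move=> kS; have := H k; rewrite kS finset.in_setT; apply.
    by move=> _; case: ifPn => [/H|/B0].
  rewrite iX// big_mkcond; apply: eq_bigr => k _; case: ifPn => // kS.
  rewrite (_ : _ @^-1` _ = setT) ?probability_setT//.
  by apply/seteqP; split=> t //= _; exact: B0.
have [k /not_implyP[kS nB]] : exists k, ~ (k \notin S -> B k 0%R) by exact/existsNP.
transitivity (P set0).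
  congr (P _); apply/seteqP; split=> t //= /(_ k).
  by rewrite finset.in_setT (negPf kS) => /(_ isT).
rewrite (bigD1 k)//= (negPf kS) (_ : _ @^-1` _ = set0) ?measure0 ?mul0e//.
by apply/seteqP; split=> t.
Qed.

Lemma mutually_independent_row (I J : finType) (S : {set I * J}) (X : I * J -> T -> R) nu :
  (forall j, (nu, j) \in S) -> mutually_independent P S X ->
  mutually_independent P [set: J]%SET (fun j => X (nu, j)).
Proof.
move=> nuS iX B mB.
pose S' : {set I * J} := [set k | k.1 == nu]%SET.
have S'S : (S' \subset S)%SET.
  by apply/fintype.subsetP => -[i j]; rewrite inE /= => /eqP->.
have := mutually_independent_sub S'S iX (B := fun k => B k.2) (fun k => mB k.2).
have -> : \prod_(k in S') P (X k @^-1` B k.2) = \prod_(j in [set: J]%SET) P (X (nu, j) @^-1` B j).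
  rewrite [RHS](eq_bigl xpredT); last by move=> k; rewrite finset.in_setT.
  rewrite (eq_bigl (fun k : I * J => (k.1 == nu) && true)); last by move=> k; rewrite inE andbT.
  rewrite (eq_bigr (fun k => P (X (k.1, k.2) @^-1` B k.2))); last by case.
  by rewrite -(pair_big (pred1 nu) xpredT (fun i j => P (X (i, j) @^-1` B j))) big_pred1_eq.
move=> <-; congr (P _); apply/seteqP; split=> t /= H.
  by move=> [i j]; rewrite inE /= => /eqP->; apply: H; rewrite finset.in_setT.
by move=> j _; apply: (H (nu, j)); rewrite inE.
Qed.

End independence.

(** * Linear independence in terms of ranks *)

Section rank.
Context (R : realType) (n : nat).

Lemma rank_adds_row (w : 'rV[R]_n) (W : 'M[R]_n) : ~~ (w <= W)%MS ->
  \rank (<<w>> + W)%MS = (\rank W).+1.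
Proof.
move=> wW; apply/eqP; rewrite eqn_leq; apply/andP; split.
  rewrite (leq_trans (mxrank_adds_leqif _ _))// -[(\rank W).+1]add1n leq_add2r mxrank_gen.
  exact: rank_leq_row.
apply: rank_ltmx; rewrite ltmxE addsmxSr addsmx_sub genmxE (negPf wW).
by [].
Qed.

Lemma rank_span_of_leq (I : finType) (N : {set I}) (x : I -> 'rV[R]_n) :
  (\rank (span_of N x) <= #|N|)%N.
Proof.
rewrite -sum1_card /span_of; elim/big_ind2: _ => [|W1 k1 W2 k2 h1 h2|i _].
- by rewrite mxrank0.
- exact: leq_trans (mxrank_adds_leqif _ _) (leq_add h1 h2).
- by rewrite mxrank_gen rank_leq_row.
Qed.

(** The rows of [N] contribute at most [#|N|] to the rank and [y] at most 1, so a maximal rank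
    forces both. This one equation is the form of linear independence carried through the
    induction. *)
Lemma rank_adds_span (I : finType) (N : {set I}) (x : I -> 'rV[R]_n) (y : 'rV[R]_n) :
  \rank (<<y>> + span_of N x)%MS = #|N|.+1 ->
  \rank (span_of N x) = #|N| /\ ~~ (y <= span_of N x)%MS.
Proof.
move=> rk; have NV := rank_span_of_leq N x; split; last first.
  apply/negP => yV; have : (#|N|.+1 <= \rank (span_of N x))%N.
    by rewrite -rk; apply: mxrankS; rewrite addsmx_sub genmxE yV submx_refl.
  by rewrite leqNgt ltnS NV.
apply/eqP; rewrite eqn_leq NV /= -ltnS -rk.
rewrite (leq_trans (mxrank_adds_leqif _ _))// -[(\rank (span_of N x)).+1]add1n leq_add2r mxrank_gen.
exact: rank_leq_row.
Qed.

Lemma rank_row_free (I : finType) (N : {set I}) (x : I -> 'rV[R]_n) (y : 'rV[R]_n) :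
  row_free (col_mx y (\matrix_(i < #|N|) x (enum_val i))) ->
  \rank (<<y>> + span_of N x)%MS = #|N|.+1.
Proof.
rewrite -row_leq_rank => /(@leq_trans _ _ _) rk; apply/eqP; rewrite eqn_leq; apply/andP; split.
  rewrite (leq_trans (mxrank_adds_leqif _ _))// -[#|N|.+1]add1n leq_add ?rank_span_of_leq//.
  by rewrite mxrank_gen rank_leq_row.
apply: rk; apply: mxrankS; rewrite col_mx_sub.
rewrite (submx_trans _ (addsmxSl _ _)) ?genmxE//=; apply: submx_trans (addsmxSr _ _).
apply/row_subP => i; rewrite rowK /span_of (sumsmx_sup (enum_val i))//; last by rewrite genmxE.
exact: enum_valP.
Qed.

End rank.

(** * Induction on the number of random rows *)

Section sum_of_squares_law.
Context (R : realType) (n : nat) (I : finType) (y : 'rV[R]_n).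
Context d (T : measurableType d) (P : probability T R) (z : I -> 'I_n -> T -> R).
Local Notation mu := (@lebesgue_measure R).
Local Notation gauss := (normal_prob (0 : R) 1).

Definition design (N : {set I}) (x0 : I -> 'rV[R]_n) (t : T) (nu : I) : 'rV[R]_n :=
  if nu \in N then x0 nu else \row_i z nu i t.

Definition gaussian_outside (N : {set I}) :=
  [/\ forall nu i, nu \notin N -> measurable_fun [set: T] (z nu i),
      forall nu i, nu \notin N -> forall A, measurable A -> P (z nu i @^-1` A) = gauss A &
      mutually_independent P [set k : I * 'I_n | k.1 \notin N]%SET (fun k => z k.1 k.2)].

Lemma gaussian_outsideU1 (N : {set I}) nu : gaussian_outside N -> gaussian_outside (nu |: N)%SET.
Proof.
case=> mz lz iz; have sN x : x \notin (nu |: N)%SET -> x \notin N.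
  by apply: contra => xN; rewrite !inE xN orbT.
split=> [x i /sN|x i /sN|]; [exact: mz|exact: lz|].
apply: mutually_independent_sub iz.
by apply/fintype.subsetP => -[x i]; rewrite !inE /= => H; apply: sN; rewrite !inE.
Qed.

Lemma gaussian_outside_row (N : {set I}) nu : nu \notin N -> gaussian_outside N ->
  gaussian_family P (z nu).
Proof.
move=> nuN [mz lz iz]; split=> [i|i|]; [exact: mz|exact: lz|].
by apply: (mutually_independent_row (X := fun k => z k.1 k.2) _ iz) => j; rewrite inE.
Qed.

Lemma SS_dist2 (M : {set I}) (x : I -> 'rV[R]_n) : SS M x y = dist2 (span_of M x) y.
Proof. by []. Qed.

Lemma span_ofU1 (N : {set I}) nu (x x0 : I -> 'rV[R]_n) : nu \notin N ->
  {in N, x =1 x0} -> span_of (nu |: N)%SET x = (<<x nu>> + span_of N x0)%MS.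
Proof.
move=> nuN xx0; rewrite /span_of big_setU1//=; congr (_ + _)%MS.
by apply: eq_bigr => i iN; rewrite xx0.
Qed.

Definition set_row (nu : I) (w : 'rV[R]_n) (x0 : I -> 'rV[R]_n) (i : I) : 'rV[R]_n :=
  if i == nu then w else x0 i.

Lemma span_of_set_row (N : {set I}) nu w (x0 : I -> 'rV[R]_n) : nu \notin N ->
  span_of (nu |: N)%SET (set_row nu w x0) = (<<w>> + span_of N x0)%MS.
Proof.
move=> nuN; rewrite (span_ofU1 (x0 := x0) nuN); first by rewrite /set_row eqxx.
by move=> i iN; rewrite /set_row; case: eqP iN nuN => // -> ->.
Qed.

Lemma measurable_design_SS (N M : {set I}) x0 : gaussian_outside N ->
  measurable_fun [set: T] (fun t => SS M (design N x0 t) y).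
Proof.
case=> mz _ _; apply: measurable_SS => nu i; rewrite /design.
have [nuN|nuN] := boolP (nu \in N); first exact: measurable_cst.
by under eq_fun do rewrite mxE; exact: mz.
Qed.

(* Row [nu] is read at [t], the other random rows at [t']. *)
Lemma freeze_row (N : {set I}) nu x0 (f : R -> \bar R) : nu \notin N ->
  gaussian_outside N -> measurable_fun setT f -> (forall u, (0 <= f u)%E) ->
  let inner t t' := f (SS [set: I]%SET (design (nu |: N)%SET (set_row nu (\row_i z nu i t) x0) t') y) in
  measurable_fun [set: T] (fun t => \int[P]_t' inner t t')%E /\
  (\int[P]_t f (SS [set: I]%SET (design N x0 t) y) = \int[P]_t \int[P]_t' inner t t')%E.
Proof.
move=> nuN [mz _ iz] mf f0 inner.
pose S := [set k : I * 'I_n | k.1 \notin N]%SET.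
(* Entries of [z] in the rows of [N] are arbitrary functions; zeroing them yields a measurable
   independent family on all indices, and the design never reads them. *)
pose Z (k : I * 'I_n) (t : T) : R := if k \in S then z k.1 k.2 t else 0.
have mZ k : measurable_fun [set: T] (Z k).
  rewrite /Z; have [kS|kS] := boolP (k \in S); last exact: measurable_cst.
  by apply: mz; move: kS; rewrite inE.
have iZ : mutually_independent P [set: I * 'I_n]%SET Z by exact: mutually_independent_zero.
pose xh (h : product_space R (I * 'I_n)%type) (i : I) : 'rV[R]_n :=
  if i \in N then x0 i else \row_j h (i, j).
pose Psi h := f (SS [set: I]%SET (xh h) y).
have mPsi : measurable_fun [set: product_space R (I * 'I_n)%type] Psi.
  apply: (measurableT_comp (f := f)
    (g := fun h : product_space R (I * 'I_n)%type => SS [set: I]%SET (xh h) y)) => //.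
  apply: measurable_SS => i j; rewrite /xh; case: (i \in N); first exact: measurable_cst.
  by under eq_fun do rewrite mxE; exact: measurable_coord.
have innerE t t' : inner t t' = Psi (fun k => Z k (if k.1 != nu then t' else t)).
  congr (f (SS _ _ y)); apply/funext => i; rewrite /design /xh /set_row !inE /Z.
  have [->|inu] := eqVneq i nu.
    by rewrite (negPf nuN); apply/rowP => j; rewrite !mxE inE /= ?eqxx nuN ?eqxx.
  rewrite /=; case: ifPn => // iN; apply/rowP => j.
  by rewrite !mxE inE /= iN ?inu.
have mz2 : measurable_fun [set: T * T]
    (fun u : T * T => (fun k => Z k (if k.1 != nu then u.2 else u.1)) : product_space R (I * 'I_n)%type).
  apply: measurable_to_product_space => k; case: (k.1 != nu).
    by apply: (measurableT_comp (f := Z k) (g := @snd T T)).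
  by apply: (measurableT_comp (f := Z k) (g := @fst T T)).
have minner : measurable_fun [set: T * T] (fun u : T * T => inner u.1 u.2).
  under eq_fun do rewrite innerE.
  by apply: (measurableT_comp (f := Psi)) mz2.
split.
  apply: (measurable_fun_fubini_tonelli_F (m2 := P) (fun u : T * T => inner u.1 u.2)) => //.
  by move=> u; exact: f0.
transitivity (\int[P]_t Psi (Z^~ t))%E.
  apply: eq_integral => t _; congr (f (SS _ _ y)); apply/funext => i.
  rewrite /design /xh; case: ifPn => // iN; apply/rowP => j.
  by rewrite !mxE /Z inE /= iN.
etransitivity; first exact: (decoupling mZ iZ (fun k => k.1 != nu) mPsi (fun h => f0 _)).
by apply: eq_integral => t _; apply: eq_integral => t' _; rewrite innerE.
Qed.

(** [k.+1] rows are random. [N] and [x0] stay general because a frozen row joins the fixed ones, and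
    the rank equation is the hypothesis that survives freezing almost surely. *)
Lemma SS_ratio_law k (N : {set I}) (x0 : I -> 'rV[R]_n) :
  #|I| = (#|N| + k.+1)%N -> (#|I| < n)%N ->
  \rank (<<y>> + span_of N x0)%MS = #|N|.+1 -> gaussian_outside N ->
  has_beta_law P ((n - #|I|)%:R / 2) ((#|I| - #|N|)%:R / 2)
    (fun t => SS [set: I]%SET (design N x0 t) y / SS N x0 y).
Proof.
elim: k N x0 => [|k IHk] N x0 IN In rk gN.
all: have [rV yV] := rank_adds_span rk.
all: have /card_gt0P[nu] : (0 < #|~: N|)%N by rewrite cardsCs finset.setCK IN addKn.
all: rewrite inE => nuN.
all: have mn : (#|N|.+1 < n)%N by apply: leq_ltn_trans In; rewrite IN -addn1 leq_add2l.
all: have gnu := gaussian_outside_row nuN gN.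
all: have step1 := one_step_law gnu rV mn yV.
  have N'T : (nu |: N)%SET = [set: I]%SET.
    by apply/eqP; rewrite eqEcard finset.subsetT cardsT cardsU1 nuN IN addn1 add1n /=.
  have -> : (#|I| - #|N|)%:R / 2 = 2^-1 :> R by rewrite IN addKn div1r.
  have <- : (#|N|.+1)%N = #|I| by rewrite IN addn1.
  move=> f mf f0; etransitivity; last exact: (step1 f mf f0).
  apply: eq_integral => t _; congr (f (_ / _)).
  rewrite -N'T SS_dist2 (span_ofU1 (x0 := x0) nuN); last by move=> i iN; rewrite /design iN.
  by rewrite /design (negPf nuN).
pose V := span_of N x0; pose w t := \row_i z nu i t.
pose U t := dist2 (<<w t>> + V)%MS y / dist2 V y.
have VE : SS N x0 y = dist2 V y by [].
have D0 : dist2 V y != 0 by exact: dist2_neq0.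
have mU : measurable_fun [set: T] U.
  apply: measurable_funM; last exact: measurable_cst.
  have := measurable_design_SS (nu |: N)%SET x0 gN.
  congr (measurable_fun _ _); apply/funext => t.
  rewrite SS_dist2 (span_ofU1 (x0 := x0) nuN); last by move=> i iN; rewrite /design iN.
  by rewrite /design (negPf nuN).
pose a : R := (n - #|I|)%:R / 2.
pose b : R := (#|I| - #|(nu |: N)%SET|)%:R / 2.
have cN' : #|(nu |: N)%SET| = #|N|.+1 by rewrite cardsU1 nuN.
have IN' : #|I| = (#|(nu |: N)%SET| + k.+1)%N by rewrite cN' IN addSnnS.
have bE : (#|I| - #|N|)%:R / 2 = b + 2^-1.
  rewrite /b cN' IN addKn -[(#|N| + k.+2)%N]addSnnS addKn.
  by rewrite -[k.+2]addn1 natrD mulrDl div1r.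
(* The parameter of the one-row law is the sum of the two parameters of the conditional law, exactly
   as [beta_product] requires. *)
have abE : (n - #|N|.+1)%:R / 2 = a + b.
  rewrite /a /b cN' -mulrDl -natrD; congr (_%:R / 2).
  by rewrite addnBA ?subnK ?(ltnW In)// IN -addn1 leq_add2l.
rewrite bE.
pose c1 := ((fine (beta_mass (a + b) 2^-1))^-1)%:E.
pose c2 := ((fine (beta_mass a b))^-1)%:E.
have c10 : (0 <= c1)%E by rewrite lee_fin invr_ge0 fine_ge0// beta_mass_ge0.
have c20 : (0 <= c2)%E by rewrite lee_fin invr_ge0 fine_ge0// beta_mass_ge0.
(* [c1] normalises the one-row law, [c2] the conditional law, and the remaining mass is produced by
   [beta_product]. *)
apply: (@has_beta_lawP _ _ _ _ _ _ _ (c1 * (c2 * beta_mass b 2^-1))%E).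
  exact: (mule_ge0 c10 (mule_ge0 c20 (beta_mass_ge0 _ _))).
move=> f mf f0.
(* The fixed denominator is absorbed into the test function, since [freeze_row] speaks of [SS]
   alone. *)
pose f' u := f (u / SS N x0 y).
have mf' : measurable_fun [set: R] f'.
  apply: (measurableT_comp (f := f) (g := fun u : R => u / SS N x0 y)) => //.
  exact: measurable_funM.
have [minner frz] := freeze_row x0 nuN gN mf' (fun u => f0 _).
etransitivity; first exact: frz.
(* The conditional expectation of the test function when the first factor [U] of the ratio equals
   u. *)
pose G u := (c2 * \int[mu]_r (f (u * r)%R * (beta_dens01 a b r)%:E))%E.
have bd0 (a' b' r : R) : (0 <= (beta_dens01 a' b' r)%:E)%E by rewrite lee_fin beta_dens01_ge0.
have fb0 (u r : R) : (0 <= f (u * r)%R * (beta_dens01 a b r)%:E)%E.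
  exact: (mule_ge0 (f0 _) (bd0 _ _ _)).
have mfr : measurable_fun [set: R * R]
    (fun v : R * R => f (v.1 * v.2)%R * (beta_dens01 a b v.2)%:E)%E.
  apply: emeasurable_funM; last by apply/measurable_EFinP; apply: measurable_beta_comp.
  by apply: (measurableT_comp (f := f) (g := fun v : R * R => v.1 * v.2)) => //; measurability_tac.
have mI : measurable_fun [set: R] (fun u => \int[mu]_r (f (u * r)%R * (beta_dens01 a b r)%:E))%E.
  exact: (measurable_integral2 mfr fb0).
have mG : measurable_fun [set: R] G.
  by apply: emeasurable_funM => //; exact: measurable_cst.
have I0 u : (0 <= \int[mu]_r (f (u * r)%R * (beta_dens01 a b r)%:E))%E.
  by apply: integral_ge0 => r _; exact: fb0.
have G0 u : (0 <= G u)%E by exact: (mule_ge0 c20 (I0 u)).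
transitivity (\int[P]_t G (U t))%E.
  apply: ge0_ae_eq_integral.
  - exact: measurableT.
  - exact: minner.
  - by apply: (measurableT_comp (f := G) (g := U)).
  - by move=> t _; apply: integral_ge0 => t' _; exact: f0.
  - by move=> t _; exact: G0.
  have := one_step_ae gnu y rV mn.
  apply: filterS => t wt _.
  have rk' : \rank (<<y>> + span_of (nu |: N)%SET (set_row nu (w t) x0))%MS =
      #|(nu |: N)%SET|.+1.
    rewrite span_of_set_row// addsmxA [(<<y>> + _)%MS]addsmxC -addsmxA rank_adds_row//.
    by rewrite rk cN'.
  have [_ yV'] := rank_adds_span rk'.
  have IH := IHk _ _ IN' In rk' (gaussian_outsideU1 nu gN).
  have D'E : SS (nu |: N)%SET (set_row nu (w t) x0) y = dist2 (<<w t>> + V)%MS y.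
    by rewrite SS_dist2 span_of_set_row.
  have D'0 : dist2 (<<w t>> + V)%MS y != 0.
    by rewrite -D'E SS_dist2; exact: dist2_neq0.
  have mft : measurable_fun [set: R] (fun u => f (U t * u)).
    apply: (measurableT_comp (f := f) (g := fun u : R => U t * u)) => //.
    exact: measurable_funM.
  etransitivity; last exact: (IH (fun u => f (U t * u)) mft (fun u => f0 _)).
  apply: eq_integral => t' _; rewrite /f' D'E VE /U; congr f.
  have E (s p q : R) : p != 0 -> q != 0 -> s / p = q / p * (s / q).
    by move=> p0 q0; field; rewrite p0 q0.
  exact: E.
have mfx (x : R) : measurable_fun [set: R] (fun r => f (x * r)%R * (beta_dens01 a b r)%:E)%E.
  apply: emeasurable_funM; last by apply/measurable_EFinP; exact: measurable_beta_dens01.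
  apply: (measurableT_comp (f := f) (g := fun r : R => x * r)) => //.
  exact: measurable_funM.
rewrite abE in step1.
etransitivity; first exact: (step1 G mG G0).
rewrite -[RHS]muleA; congr (_ * _)%E; rewrite -muleA.
transitivity (\int[mu]_x (c2 * \int[mu]_r (f (x * r)%R *
    (beta_dens01 (a + b) 2^-1 x * beta_dens01 a b r)%:E)))%E.
  apply: eq_integral => x _; rewrite /G -muleA; congr (_ * _)%E.
  rewrite muleC; apply/esym.
  transitivity (\int[mu]_r ((beta_dens01 (a + b) 2^-1 x)%:E *
      (f (x * r)%R * (beta_dens01 a b r)%:E)))%E.
    by apply: eq_integral => r _; rewrite muleCA EFinM.
  apply: ge0_integralZl.
  - exact: measurableT.
  - exact: mfx.
  - by move=> r _; exact: fb0.
  - exact: bd0.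
have fbb0 (x r : R) :
    (0 <= f (x * r)%R * (beta_dens01 (a + b) 2^-1 x * beta_dens01 a b r)%:E)%E.
  by apply: mule_ge0; [exact: f0|rewrite lee_fin mulr_ge0 ?beta_dens01_ge0].
have mfbb : measurable_fun [set: R * R] (fun v : R * R => f (v.1 * v.2)%R *
    (beta_dens01 (a + b) 2^-1 v.1 * beta_dens01 a b v.2)%:E)%E.
  apply: emeasurable_funM.
    by apply: (measurableT_comp (f := f) (g := fun v : R * R => v.1 * v.2)) => //; measurability_tac.
  by apply/measurable_EFinP; apply: measurable_funM; apply: measurable_beta_comp.
have mIbb := measurable_integral2 mfbb fbb0.
etransitivity.
  apply: ge0_integralZl.
  - exact: measurableT.
  - exact: mIbb.
  - by move=> x _; apply: integral_ge0 => r _; exact: fbb0.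
  - exact: c20.
congr (_ * _)%E; exact: beta_product.
Qed.

End sum_of_squares_law.

(** Independent standard Gaussian vectors are encoded by their scalar entries: each is standard
    normal, and all entries of all rows outside [N] are jointly independent. *)
Theorem theorem1 (R : realType) (n : nat) (I : finType) (N : {set I})
  (y : 'rV[R]_n) (x0 : I -> 'rV[R]_n)
  (d : measure_display) (T : measurableType d) (P : probability T R)
  (z : I -> 'I_n -> T -> R) :
  (0 < n)%N ->
  (N \proper [set: I])%SET ->
  (#|N| < #|I| < n)%N ->
  row_free (col_mx y (\matrix_(i < #|N|) x0 (enum_val i))) ->
  (forall nu i, nu \notin N -> measurable_fun setT (z nu i)) ->
  (forall nu i, nu \notin N -> forall A, measurable A ->
      P (z nu i @^-1` A) = normal_prob 0 1 A) ->
  mutually_independent P [set k : I * 'I_n | k.1 \notin N]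
    (fun k => z k.1 k.2) ->
  let x (t : T) (nu : I) : 'rV[R]_n :=
    if nu \in N then x0 nu else \row_i z nu i t in
  let SSstar (t : T) : R := SS [set: I] (x t) y in
  let SSN : R := SS N x0 y in
  measurable_fun setT SSstar /\
  forall A : set R, measurable A ->
    P ((fun t => SSstar t / SSN) @^-1` A) =
    beta_meas ((n - #|I|)%:R / 2) ((#|I| - #|N|)%:R / 2) A.
Proof.
move=> _ _ /andP[NI In] rf mz lz iz x SSstar SSN.
have gN : gaussian_outside P z N by split.
(* The induction runs on one less than the number of random rows, which is positive. *)
have IN : #|I| = (#|N| + (#|I| - #|N|).-1.+1)%N.
  by rewrite prednK ?subn_gt0// subnKC// ltnW.
have law := SS_ratio_law IN In (rank_row_free rf) gN.
have mS : measurable_fun setT SSstar := measurable_design_SS y [set: I] x0 gN.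
split=> // A mA; apply: (has_beta_law_prob _ law mA).
by apply: measurable_funM => //; exact: measurable_cst.
Qed.
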